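(* Let $\pi:E\to M$ be a bundle. Let $n\ge 1$, let $x_n\in\mathbf{J}^n(\pi)$ and let $\nabla_{x_n}\in\mathbf{J}^{n+1}(\pi)$ be an $(n+1)$-tangential with $\pi_{n+1,n}(\nabla_{x_n})=x_n$. Then the mapping $\varphi_{n+1}(\nabla_{x_n}):(M\otimes\mathcal{W}_{D^{n+1}})_{\pi_n(x_n)}\to(E\otimes\mathcal{W}_{D^{n+1}})_{\pi_{n,0}(x_n)}$ is a $D^{n+1}$-tangential over $\pi$ at $\pi_{n,0}(x_n)$, that is, $$\varphi_{n+1}(\nabla_{x_n})\in\mathbb{J}^{D^{n+1}}(\pi).$$ (Hence, inductively, one obtains mappings $\varphi_n:\mathbf{J}^n(\pi)\to\mathbb{J}^{D^n}(\pi)$ for all $n$.)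
   Context: **Frölicher spaces, Weil prolongation.** $\mathbf{FS}$ is the (cartesian closed) category of Frölicher spaces and smooth mappings; all mappings below are smooth, subsets carry the subspace structure. A Weil algebra is $W=C^\infty(\mathbb{R}^k)/I$, with $I$ contained in the ideal $\mathfrak m$ of functions vanishing at $0$ and containing a power of $\mathfrak m$. $X\otimes W$ is the quotient of $X^{\mathbb{R}^k}$ by $f\sim g$ iff $f(0)=g(0)$ and $h\circ f-h\circ g\in I$ for all smooth $h:X\to\mathbb{R}$. This is a bifunctor: $u\otimes\mathrm{id}_W$ sends $[f]$ to $[u\circ f]$, and $\mathrm{id}_X\otimes\phi$ sends $[f]$ to $[f\circ\theta]$ where the smooth map $\theta$ with $\theta(0)=0$ induces $\phi$. There is a canonical projection $X\otimes W\to X$; $(X\otimes W)_x$ is its fibre over $x$. Infinitesimal objects are formal duals of Weil algebras: $D=\{d:d^2=0\}$, $D_m=\{d:d^{m+1}=0\}$, $\mathcal{W}_{D^n}=\mathbb{R}[X_1,\dots,X_n]/(X_1^2,\dots,X_n^2)$, $\mathcal{W}_{D_m}=\mathbb{R}[X]/(X^{m+1})$; a polynomial map $f:\mathbb{D}\to\mathbb{D}'$ induces by substitution $\mathcal{W}_f:\mathcal{W}_{\mathbb{D}'}\to\mathcal{W}_{\mathbb{D}}$; products of infinitesimal objects correspond to tensor products $\otimes_\infty$. $X$ is Weil exponentiable if $(X\otimes(W_1\otimes_\infty W_2))^Y=(X\otimes W_1)^Y\otimes W_2$ naturally for all Frölicher spaces $Y$ and Weil algebras $W_1,W_2$ (in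 particular $X\otimes\mathcal{W}_{\mathbb{D}\times\mathbb{D}'}=(X\otimes\mathcal{W}_{\mathbb{D}})\otimes\mathcal{W}_{\mathbb{D}'}$). $X$ is microlinear if $X\otimes-$ sends finite limit diagrams of Weil algebras to limit diagrams in $\mathbf{FS}$. Convention: all Frölicher spaces occurring are microlinear and Weil exponentiable; a bundle is just a smooth mapping $\pi:E\to M$ of such spaces. Weil functors $-\otimes W$ preserve finite limits. **Operations.** For $\gamma\in X\otimes\mathcal{W}_{D^n}$: $\gamma^\sigma=(\mathrm{id}_X\otimes\mathcal{W}_{(d_1,\dots,d_n)\mapsto(d_{\sigma(1)},\dots,d_{\sigma(n)})})(\gamma)$ for $\sigma\in\mathbf{S}_n$; $\alpha\underset{i}{\cdot}\gamma=(\mathrm{id}_X\otimes\mathcal{W}_{(d_1,\dots,d_n)\mapsto(d_1,\dots,\alpha d_i,\dots,d_n)})(\gamma)$ for $\alpha\in\mathbb{R}$; $\mathbf{s}_i:X\otimes\mathcal{W}_{D^n}\to X\otimes\mathcal{W}_{D^{n+1}}$ is induced by the map $D^{n+1}\to D^n$ deleting $d_i$; $\mathbf{d}_i:X\otimes\mathcal{W}_{D^{n+1}}\to X\otimes\mathcal{W}_{D^n}$ is induced by the map $D^n\to D^{n+1}$ inserting $0$ at the $i$-th place. **$D^n$-pseudotangentials and $D^n$-tangentials.** A $D^n$-pseudotangential over $\pi$ at $x\in E$ is a mapping $\nabla_x:(M\otimes\mathcal{W}_{D^n})_{\pi(x)}\to(E\otimes\mathcal{W}_{D^n})_x$ such that: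 (1) $(\pi\otimes\mathrm{id})(\nabla_x(\gamma))=\gamma$; (2) $\nabla_x(\alpha\underset{i}{\cdot}\gamma)=\alpha\underset{i}{\cdot}\nabla_x(\gamma)$ for $\alpha\in\mathbb{R}$, $1\le i\le n$; (3) for all $m$ and $1\le i\le n$, with $\mu_i:D^n\times D_m\to D^n$, $(d_1,\dots,d_n,e)\mapsto(d_1,\dots,ed_i,\dots,d_n)$, one has $(\nabla_x\otimes\mathrm{id}_{\mathcal{W}_{D_m}})\circ(\mathrm{id}_M\otimes\mathcal{W}_{\mu_i})=(\mathrm{id}_E\otimes\mathcal{W}_{\mu_i})\circ\nabla_x$; (4) $\nabla_x(\gamma^\sigma)=(\nabla_x(\gamma))^\sigma$ for $\sigma\in\mathbf{S}_n$. $\hat{\mathbb{J}}^{D^n}(\pi)$ is the set of all of them over all $x\in E$ ($\hat{\mathbb{J}}^{D^0}(\pi)=E$), and $\hat\pi_{n+1,n}:\hat{\mathbb{J}}^{D^{n+1}}(\pi)\to\hat{\mathbb{J}}^{D^n}(\pi)$ is $\hat\pi_{n+1,n}(\nabla_x)=\mathbf{d}_{n+1}\circ\nabla_x\circ\mathbf{s}_{n+1}$. A $D$-tangential is a $D$-pseudotangential. Inductively, a $D^{n+1}$-pseudotangential $\nabla_x$ is a $D^{n+1}$-tangential if $\hat\pi_{n+1,n}(\nabla_x)$ is a $D^n$-tangential and, with $\kappa:D^{n+1}\to D^n$, $(d_1,\dots,d_{n+1})\mapsto(d_1,\dots,d_{n-1},d_nd_{n+1})$, $\nabla_x((\mathrm{id}_M\otimes\mathcal{W}_\kappa)(\gamma))=(\mathrm{id}_E\otimes\mathcal{W}_\kappa)(\hat\pi_{n+1,n}(\nabla_x)(\gamma))$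 for all $\gamma\in(M\otimes\mathcal{W}_{D^n})_{\pi(x)}$. $\mathbb{J}^{D^n}(\pi)$ is the set of $D^n$-tangentials; $\mathbb{J}^{D^0}(\pi)=E$. **$n$-tangentials (first approach).** A $1$-tangential over $\pi$ at $x\in E$ is the same as a $D$-pseudotangential over $\pi$ at $x$; $\mathbf{J}^1(\pi)$ is the set of all of them, $\pi_{1,0}:\mathbf{J}^1(\pi)\to E$ sends $\nabla_x$ to $x$, and $\pi_1=\pi\circ\pi_{1,0}$. Put $\mathbf{J}^0(\pi)=E$, $\pi_0=\pi$. If $F$ is a morphism of bundles over $M$ from $\pi$ to $\pi'$, a $1$-tangential $\nabla_x$ over $\pi$ is $F$-related to a $1$-tangential $\nabla_{F(x)}$ over $\pi'$ if $(F\otimes\mathrm{id}_{\mathcal{W}_D})(\nabla_x(t))=\nabla_{F(x)}(t)$ for all $t\in(M\otimes\mathcal{W}_D)_{\pi(x)}$. For $k\ge1$, $\mathbf{J}^{k+1}(\pi)$ is the subspace of $\mathbf{J}^1(\pi_k)$ (where $\pi_k:\mathbf{J}^k(\pi)\to M$) of those $\nabla_x$, $x=\nabla_y\in\mathbf{J}^k(\pi)$, such that (a) $\nabla_x$ is $\pi_{k,k-1}$-related to $\nabla_y$; (b) $\Phi(\gamma^\sigma)=\Phi(\gamma)^\sigma$ for all $\gamma\in(M\otimes\mathcal{W}_{D^2})_{\pi_k(x)}$, where $\sigma$ is the transposition in $\mathbf{S}_2$ and $\Phi(\gamma)\in\mathbf{J}^{k-1}(\pi)\otimes\mathcal{W}_{D^2}$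 is obtained as follows: let $t=(\mathrm{id}_M\otimes\mathcal{W}_{d\mapsto(0,d)})(\gamma)$; regard $(\nabla_x(t),\gamma)$ as an element of $(\mathbf{J}^k(\pi)\otimes\mathcal{W}_D)\times_{M\otimes\mathcal{W}_D}((M\otimes\mathcal{W}_D)\otimes\mathcal{W}_D)=(\mathbf{J}^k(\pi)\times_M(M\otimes\mathcal{W}_D))\otimes\mathcal{W}_D$ (the outer $\mathcal{W}_D$ being the second coordinate of $D^2$), and apply $\mathrm{ev}\otimes\mathrm{id}_{\mathcal{W}_D}$, $\mathrm{ev}(\nabla,t)=\nabla(t)\in\mathbf{J}^{k-1}(\pi)\otimes\mathcal{W}_D$. Put $\pi_{k+1,k}(\nabla_x)=x$, $\pi_{k+1}=\pi_k\circ\pi_{k+1,k}$, and $\pi_{n,0}:\mathbf{J}^n(\pi)\to E$ the composite of the $\pi_{k+1,k}$. Elements of $\mathbf{J}^n(\pi)$ are called $n$-tangentials. The spaces $\mathbf{J}^k(\pi)$ and $\mathbb{J}^{D^n}(\pi)$ are regarded as Frölicher spaces (falling under the convention above) with the fibrewise function-space structure, for which projections, evaluation maps and the $\varphi_n$ below are smooth. **The mappings $\varphi_n$.** $\varphi_0=\mathrm{id}_E$, and $\varphi_1:\mathbf{J}^1(\pi)\to\mathbb{J}^{D}(\pi)$ is the identity. Inductively, given $\varphi_n:\mathbf{J}^n(\pi)\to\mathbb{J}^{D^n}(\pi)$, $x_n\in\mathbf{J}^n(\pi)$ and $\nabla_{x_n}\in\mathbf{J}^{n+1}(\pi)$ over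 $x_n$, define $\varphi_{n+1}(\nabla_{x_n})(\gamma)$ for $\gamma\in(M\otimes\mathcal{W}_{D^{n+1}})_{\pi_n(x_n)}\subset(M\otimes\mathcal{W}_{D^n})\otimes\mathcal{W}_D$ (outer $\mathcal{W}_D$ = last coordinate) as follows: let $t\in(M\otimes\mathcal{W}_D)_{\pi_n(x_n)}$ be the image of $\gamma$ under $p\otimes\mathrm{id}_{\mathcal{W}_D}$, $p:M\otimes\mathcal{W}_{D^n}\to M$ the canonical projection; form $((\varphi_n\otimes\mathrm{id}_{\mathcal{W}_D})(\nabla_{x_n}(t)),\gamma)\in(\mathbb{J}^{D^n}(\pi)\otimes\mathcal{W}_D)\times_{M\otimes\mathcal{W}_D}((M\otimes\mathcal{W}_{D^n})\otimes\mathcal{W}_D)=(\mathbb{J}^{D^n}(\pi)\times_M(M\otimes\mathcal{W}_{D^n}))\otimes\mathcal{W}_D$; apply $\big((\nabla,\gamma)\mapsto\nabla(\gamma)\in E\otimes\mathcal{W}_{D^n}\big)\otimes\mathrm{id}_{\mathcal{W}_D}$ to get an element of $(E\otimes\mathcal{W}_{D^n})\otimes\mathcal{W}_D=E\otimes\mathcal{W}_{D^{n+1}}$. *)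

(* Defs.v *)
(* Real numbers and one-variable calculus come from Stdlib and Coquelicot;
   MathComp only provides finite index types and permutations. *)
From Stdlib Require Import Reals FunctionalExtensionality ClassicalEpsilon.
From mathcomp Require Import all_boot fingroup perm.
From Coquelicot Require Import Coquelicot.

Set Implicit Arguments.
Unset Strict Implicit.
Unset Printing Implicit Defensive.

Open Scope R_scope.

(** * Frölicher spaces *)

Definition smoothR (g : R -> R) : Prop := forall n x, ex_derive_n g n x.

Definition dual_scalars (T : Type) (C : (R -> T) -> Prop) (h : T -> R) : Prop :=
  forall c, C c -> smoothR (fun t => h (c t)).

Definition dual_curves (T : Type) (F : (T -> R) -> Prop) (c : R -> T) : Prop :=
  forall h, F h -> smoothR (fun t => h (c t)).

Record frolicher := Frolicher {
  points :> Type;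
  curve : (R -> points) -> Prop;
  scalar : (points -> R) -> Prop;
  curveP : forall c, curve c <-> dual_curves scalar c;
  scalarP : forall h, scalar h <-> dual_scalars curve h }.

Definition smooth (X Y : frolicher) (f : X -> Y) : Prop :=
  forall c : R -> X, curve c -> curve (fun t => f (c t)).

Record hom (X Y : frolicher) := Hom { hom_fun :> X -> Y; hom_smooth : smooth hom_fun }.

Fact gen_curvesP T (C : (R -> T) -> Prop) h :
  dual_scalars C h <-> dual_scalars (dual_curves (dual_scalars C)) h.
Proof. by split=> [hC c|hC c Cc]; [exact|apply: hC => k; exact]. Qed.

Fact gen_scalarsP T (F : (T -> R) -> Prop) c :
  dual_curves F c <-> dual_curves (dual_scalars (dual_curves F)) c.
Proof. by split=> [hF h|hF h Fh]; [exact|apply: hF => k; exact]. Qed.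

(* The finest structure for which the members of [C] are smooth curves. *)
Definition gen_curves (T : Type) (C : (R -> T) -> Prop) : frolicher :=
  @Frolicher T (dual_curves (dual_scalars C)) (dual_scalars C)
    (fun _ => iff_refl _) (gen_curvesP C).

(* The coarsest structure for which the members of [F] are smooth functions. *)
Definition gen_scalars (T : Type) (F : (T -> R) -> Prop) : frolicher :=
  @Frolicher T (dual_curves F) (dual_scalars (dual_curves F))
    (gen_scalarsP F) (fun _ => iff_refl _).

Definition line : frolicher := gen_scalars (fun h : R -> R => h = id).

Definition Rn (K : Type) : frolicher :=
  gen_scalars (fun h : (K -> R) -> R => exists i, h = fun x => x i).

Definition product (X Y : frolicher) : frolicher :=
  gen_scalars (fun h : X * Y -> R =>
    (exists2 f : X -> R, scalar f & h = fun z => f z.1) \/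
    (exists2 g : Y -> R, scalar g & h = fun z => g z.2)).

Definition subspace (X : frolicher) (P : X -> Prop) : frolicher :=
  gen_scalars (fun h : {x | P x} -> R =>
    exists2 f : X -> R, scalar f & h = fun z => f (proj1_sig z)).

Definition incl (X : frolicher) (P : X -> Prop) (z : subspace P) : X := proj1_sig z.

Definition expo (Y X : frolicher) : frolicher :=
  gen_curves (fun c : R -> hom Y X => smooth (fun z : product line Y => c z.1 z.2)).

Definition diffeo (X Y : frolicher) (f : X -> Y) : Prop :=
  smooth f /\ exists g : Y -> X, [/\ smooth g, cancel f g & cancel g f].

(** * Weil algebras *)

(* Classical smoothness on R^K: all iterated partial derivatives exist and are
   continuous (K is finite, so Coquelicot's uniform structure on K -> R is the
   product one). *)

Definition upd (K : finType) (x : K -> R) (i : K) (h : R) : K -> R :=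
  fun j => if j == i then h else x j.

Definition pder (K : finType) (i : K) (f : (K -> R) -> R) : (K -> R) -> R :=
  fun x => Derive (fun h => f (upd x i h)) (x i).

Definition Cinf (K : finType) (f : (K -> R) -> R) : Prop :=
  forall (s : seq K) (x : K -> R),
    continuous (foldr (@pder K) f s) x /\
    forall i, ex_derive (fun h => foldr (@pder K) f s (upd x i h)) (x i).

Definition origin (K : Type) : K -> R := fun _ => 0.
Arguments origin {K}.

Definition closed_ideal (K : finType) (I : ((K -> R) -> R) -> Prop) : Prop :=
  [/\ I (fun _ => 0),
      forall f g, I f -> I g -> I (fun x => f x + g x) &
      forall a f, Cinf a -> I f -> I (fun x => a x * f x)].

(* A presentation stands for the quotient of C^oo(R^idx) by [ideal]. *)
Record presentation := Presentation {
  idx : finType;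
  ideal : ((idx -> R) -> R) -> Prop;
  ideal_closed : closed_ideal ideal }.
Arguments ideal : clear implicits.

Definition maxideal (K : finType) (f : (K -> R) -> R) : Prop := Cinf f /\ f origin = 0.

(* An ideal contains the r-th power of the maximal ideal iff it contains the
   r-fold products of its elements. *)
Definition weil (W : presentation) : Prop :=
  (forall f, ideal W f -> maxideal f) /\
  exists r, forall f : 'I_r -> (idx W -> R) -> R, (forall j, maxideal (f j)) ->
    ideal W (fun x => \big[Rmult/1]_(j < r) f j x).

Definition gen_ideal (K : finType) (G : ((K -> R) -> R) -> Prop)
    (f : (K -> R) -> R) : Prop :=
  forall I : ((K -> R) -> R) -> Prop, closed_ideal I -> (forall k, I k -> Cinf k) ->
    (forall k, G k -> I k) -> I f.

Fact gen_ideal_closed (K : finType) (G : ((K -> R) -> R) -> Prop) :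
  closed_ideal (gen_ideal G).
Proof.
split=> [I [] //|f g hf hg I hI hC hG|a f ha hf I hI hC hG]; case: (hI) => _ hD hM.
- by apply: hD; [apply: hf|apply: hg].
- by apply: hM => //; apply: hf.
Qed.

Definition gen_presentation (K : finType) (G : ((K -> R) -> R) -> Prop) : presentation :=
  Presentation (gen_ideal_closed G).

(* [Dn n] presents R[X_1..X_n]/(X_1^2..X_n^2), and [Dm m] presents R[X]/(X^(m+1)). *)
Definition Dn (n : nat) : presentation :=
  @gen_presentation 'I_n (fun f => exists i, f = fun x => (x i) ^ 2).

Definition Dm (m : nat) : presentation :=
  @gen_presentation 'I_1 (fun f => f = fun x => (x ord0) ^ m.+1).

Definition wtensor (W1 W2 : presentation) : presentation :=
  @gen_presentation (idx W1 + idx W2)%type (fun f =>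
    (exists2 g, ideal W1 g & f = fun z => g (fun i => z (inl i))) \/
    (exists2 g, ideal W2 g & f = fun z => g (fun j => z (inr j)))).

(* [weil_hom W W' th]: f |-> f \o th induces an algebra homomorphism W -> W'. *)
Definition weil_hom (W W' : presentation) (th : (idx W' -> R) -> (idx W -> R)) : Prop :=
  [/\ smooth (th : Rn (idx W') -> Rn (idx W)), th origin = origin &
      forall f, ideal W f -> ideal W' (fun x => f (th x))].

(** * Weil prolongation *)

Definition germ_equiv (X : frolicher) (W : presentation) (f g : hom (Rn (idx W)) X) : Prop :=
  f origin = g origin /\
  forall h : X -> R, scalar h -> ideal W (fun x => h (f x) - h (g x)).

(* Points of the quotient are equivalence classes; its structure is the
   quotient structure of the function space. *)
Definition class (X : frolicher) (W : presentation) : Type :=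
  {A : hom (Rn (idx W)) X -> Prop | exists f, A = germ_equiv f}.

Definition cl (X : frolicher) (W : presentation) (f : hom (Rn (idx W)) X) : class X W :=
  exist _ (germ_equiv f) (ex_intro _ f erefl).

Definition prolong (X : frolicher) (W : presentation) : frolicher :=
  gen_curves (fun c : R -> class X W =>
    exists2 c0 : R -> expo (Rn (idx W)) X, curve c0 & c = fun t => cl (c0 t)).

Notation "X ⊗ W" := (prolong X W) (at level 40, left associativity).

Fact const_smooth (X Y : frolicher) (y : Y) : smooth (fun _ : X => y).
Proof. by move=> c _; apply/curveP => h _ n x; apply: ex_derive_n_const. Qed.

Definition rep (X : frolicher) (W : presentation) (xi : X ⊗ W) : hom (Rn (idx W)) X :=
  proj1_sig (constructive_indefinite_description _ (proj2_sig xi)).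

(* The class [f] of a smooth f. For other f the value is the class of the constant
   map f(0), which keeps jet, tmap and pull total; whenever evaluation maps are
   smooth, the constructions below only involve smooth maps. *)
Definition jet (X : frolicher) (W : presentation) (f : (idx W -> R) -> X) : X ⊗ W :=
  match excluded_middle_informative (smooth (f : Rn (idx W) -> X)) with
  | left s => cl (Hom s)
  | right _ => cl (Hom (@const_smooth (Rn (idx W)) X (f origin)))
  end.

Definition proj (X : frolicher) (W : presentation) (xi : X ⊗ W) : X := rep xi origin.

Arguments jet {X} W f.

(* u ⊗ id_W : [f] |-> [u \o f] *)
Definition tmap (X Y : frolicher) (W : presentation) (u : X -> Y) (xi : X ⊗ W) : Y ⊗ W :=
  jet W (fun x => u (rep xi x)).

(* id_X ⊗ phi : [f] |-> [f \o th], for phi : W -> W' induced by th *)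
Definition pull (X : frolicher) (W W' : presentation)
    (th : (idx W' -> R) -> (idx W -> R)) (xi : X ⊗ W) : X ⊗ W' :=
  jet W' (fun x => rep xi (th x)).
Arguments pull {X} W W' th xi.

Definition glue (I J : Type) (x : I -> R) (y : J -> R) : I + J -> R :=
  fun k => match k with inl i => x i | inr j => y j end.

(* The identification X ⊗ (W1 ⊗ W2) = (X ⊗ W1) ⊗ W2. *)
Definition curry (X : frolicher) (W1 W2 : presentation)
    (xi : X ⊗ wtensor W1 W2) : (X ⊗ W1) ⊗ W2 :=
  jet W2 (fun y => jet W1 (fun x => rep xi (glue x y))).

Definition snoc (n : nat) (z : 'I_n + 'I_1 -> R) : 'I_n.+1 -> R :=
  fun j => if unlift ord_max j is Some i then z (inl i) else z (inr ord0).

(* The identification X ⊗ W_{D^(n+1)} = (X ⊗ W_{D^n}) ⊗ W_D, where the outer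
   W_D corresponds to the last coordinate. *)
Definition curryD (X : frolicher) (n : nat) (xi : X ⊗ Dn n.+1) : (X ⊗ Dn n) ⊗ Dn 1 :=
  curry (pull (Dn n.+1) (wtensor (Dn n) (Dn 1)) (@snoc n) xi).

Fact proj_cl (X : frolicher) (W : presentation) (f : hom (Rn (idx W)) X) :
  proj (cl f : X ⊗ W) = f origin.
Proof.
rewrite /proj /rep; case: constructive_indefinite_description => g /= e.
suff [] : germ_equiv f g by [].
rewrite e; split=> // h _; case: (ideal_closed W) => h0 _ _.
suff -> : (fun x => h (g x) - h (g x)) = fun _ => 0 by [].
by apply: functional_extensionality => x; apply: Rminus_diag_eq.
Qed.

Fact proj_jet (X : frolicher) (W : presentation) (f : (idx W -> R) -> X) :
  proj (jet W f) = f origin.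
Proof. by rewrite /jet; case: excluded_middle_informative => s; rewrite proj_cl. Qed.

Fact proj_pull (X : frolicher) (W W' : presentation)
    (th : (idx W' -> R) -> (idx W -> R)) (xi : X ⊗ W) (th0 : th origin = origin) :
  proj (pull W W' th xi) = proj xi.
Proof. by rewrite /pull proj_jet th0. Qed.

(** * Weil exponentiability and microlinearity *)

(* The isomorphism (X ⊗ W1)^Y ⊗ W2 = (X ⊗ (W1 ⊗ W2))^Y is the canonical one:
   evaluated at a point y of Y it is, whatever the representative f,
   the correspondence between [f] and [b |-> [a |-> f (a, b)]]. *)
Definition weil_exponentiable (X : frolicher) : Prop :=
  forall (Y : frolicher) (W1 W2 : presentation), weil W1 -> weil W2 ->
  exists2 Th : (expo Y (X ⊗ W1)) ⊗ W2 -> expo Y (X ⊗ wtensor W1 W2),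
    diffeo Th &
    forall u y (f : hom (Rn (idx (wtensor W1 W2))) X), Th u y = cl f ->
      tmap (fun g : expo Y (X ⊗ W1) => g y) u
      = jet W2 (fun b => jet W1 (fun a => f (glue a b))).

(* A finite diagram of Weil algebras: a finite graph with vertices and arrows
   labelled by Weil algebras and homomorphisms. *)
Record wdiagram := WDiagram {
  vertex : finType;
  arrow : finType;
  src : arrow -> vertex;
  tgt : arrow -> vertex;
  wobj : vertex -> presentation;
  warr : forall a, (idx (wobj (tgt a)) -> R) -> (idx (wobj (src a)) -> R);
  wobjP : forall v, weil (wobj v);
  warrP : forall a, weil_hom (@warr a) }.

Definition wcone (D : wdiagram) (L : presentation)
    (la : forall v : vertex D, (idx (wobj v) -> R) -> (idx L -> R)) : Prop :=
  (forall v, weil_hom (@la v)) /\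
  forall (a : arrow D) (f : (idx L -> R) -> R), Cinf f ->
    ideal (wobj (tgt a)) (fun x => f (la (src a) (warr x)) - f (la (tgt a) x)).

(* Limits are those of R-algebras, hence created by the underlying sets: L is
   the algebra of compatible families. (Limits taken inside the category of Weil
   algebras would be a different, degenerate notion: R is terminal there.) *)
Definition wlimit (D : wdiagram) (L : presentation)
    (la : forall v : vertex D, (idx (wobj v) -> R) -> (idx L -> R)) : Prop :=
  [/\ wcone la,
      (forall f : (forall v : vertex D, (idx (wobj v) -> R) -> R),
        (forall v, Cinf (f v)) ->
        (forall a : arrow D, ideal (wobj (tgt a)) (fun x => f (src a) (warr x) - f (tgt a) x)) ->
        exists2 g : (idx L -> R) -> R, Cinf g &
          forall v, ideal (wobj v) (fun x => g (la v x) - f v x)) &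
      forall g : (idx L -> R) -> R, Cinf g ->
        (forall v, ideal (wobj v) (fun x => g (la v x))) -> ideal L g].

Definition microlinear (X : frolicher) : Prop :=
  forall (D : wdiagram) (L : presentation)
    (la : forall v : vertex D, (idx (wobj v) -> R) -> (idx L -> R)),
  weil L -> wlimit la ->
  forall (Y : frolicher) (q : forall v : vertex D, Y -> X ⊗ wobj v),
    (forall v, smooth (q v)) ->
    (forall (a : arrow D) y, pull _ _ (@warr D a) (q (src a) y) = q (tgt a) y) ->
    exists! u : Y -> X ⊗ L,
      smooth u /\ forall v y, pull _ _ (la v) (u y) = q v y.

(* The standing convention on the spaces under consideration and on their
   prolongations. *)
Definition admissible (X : frolicher) : Prop :=
  [/\ weil_exponentiable X, microlinear X &
      forall W, weil W -> weil_exponentiable (X ⊗ W) /\ microlinear (X ⊗ W)].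

(** * Fibre products *)

(* B x_M (M ⊗ W), for rho : B -> M *)
Definition fibprod (B M : frolicher) (rho : B -> M) (W : presentation) : frolicher :=
  subspace (fun z : product B (M ⊗ W) => proj z.2 = rho z.1).

Definition fibprod1 (B M : frolicher) (rho : B -> M) (W : presentation)
  (z : fibprod rho W) : B := (incl z).1.

Definition fibprod2 (B M : frolicher) (rho : B -> M) (W : presentation)
  (z : fibprod rho W) : M ⊗ W := (incl z).2.

Definition pullback (P X Y Z : frolicher) (p : P -> X) (q : P -> Y)
    (f : X -> Z) (g : Y -> Z) : Prop :=
  (forall z, f (p z) = g (q z)) /\
  forall (T : frolicher) (a : T -> X) (b : T -> Y), smooth a -> smooth b ->
    (forall t, f (a t) = g (b t)) ->
    exists! u : T -> P,
      [/\ smooth u, forall t, p (u t) = a t & forall t, q (u t) = b t].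

(* The fibre products B x_M (M ⊗ W) are preserved by Weil functors. This cannot be
   asked of all finite limits in Frölicher spaces: the equalizer of s^2 and 0 on the
   line is a point, whereas after prolongation by R[X]/(X^2) it is a line. *)
Definition fibprod_preserved (B M : frolicher) (rho : B -> M) : Prop :=
  forall W W' : presentation, weil W -> weil W' ->
    pullback (tmap (W := W') (@fibprod1 B M rho W)) (tmap (W := W') (@fibprod2 B M rho W))
             (tmap (W := W') rho) (tmap (W := W') (@proj M W)).

(** * Operations on X ⊗ W_{D^n} *)

(* Coordinates are numbered from 0. *)

Definition perm_map (n : nat) (s : 'S_n) (d : 'I_n -> R) : 'I_n -> R := fun j => d (s j).

Definition scale_map (n : nat) (a : R) (i : 'I_n) (d : 'I_n -> R) : 'I_n -> R :=
  fun j => if j == i then a * d j else d j.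

Definition delete_map (n : nat) (i : 'I_n.+1) (d : 'I_n.+1 -> R) : 'I_n -> R :=
  fun j => d (lift i j).

Definition insert_map (n : nat) (i : 'I_n.+1) (d : 'I_n -> R) : 'I_n.+1 -> R :=
  fun j => if unlift i j is Some k then d k else 0.

Definition mu_map (n : nat) (i : 'I_n) (z : 'I_n + 'I_1 -> R) : 'I_n -> R :=
  fun j => if j == i then z (inr ord0) * z (inl j) else z (inl j).

(* (d_0, .., d_(n+1)) |-> (d_0, .., d_(n-1), d_n * d_(n+1)) *)
Definition kappa_map (n : nat) (d : 'I_n.+2 -> R) : 'I_n.+1 -> R :=
  fun j => if j == ord_max then d (lift ord_max j) * d ord_max else d (lift ord_max j).

Fact perm_map0 n (s : 'S_n) : perm_map s origin = origin.
Proof. by []. Qed.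

Fact scale_map0 n a (i : 'I_n) : scale_map a i origin = origin.
Proof.
by apply: functional_extensionality => j; rewrite /scale_map /origin Rmult_0_r; case: eqP.
Qed.

Fact delete_map0 n (i : 'I_n.+1) : delete_map i origin = origin.
Proof. by []. Qed.

Fact insert_map0 n (i : 'I_n.+1) : insert_map i origin = origin.
Proof. by apply: functional_extensionality => j; rewrite /insert_map; case: unlift. Qed.

Fact kappa_map0 n : @kappa_map n origin = origin.
Proof.
by apply: functional_extensionality => j; rewrite /kappa_map /origin Rmult_0_r; case: eqP.
Qed.

(* The fibre (M ⊗ W_{D^n})_m *)
Definition fib (M : frolicher) (n : nat) (m : M) : frolicher :=
  subspace (fun g : M ⊗ Dn n => proj g = m).

Definition fpull (M : frolicher) (n n' : nat) (m : M)
    (th : ('I_n' -> R) -> ('I_n -> R)) (th0 : th origin = origin) (g : fib n m) : fib n' m :=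
  exist _ (pull (Dn n) (Dn n') th (incl g))
    (etrans (@proj_pull M (Dn n) (Dn n') th (incl g) th0) (proj2_sig g)).

(** * Pseudotangentials and tangentials *)

Record fibmap (n : nat) (B M : frolicher) (rho : B -> M) := Fibmap {
  base : B;
  fmap :> fib n (rho base) -> B ⊗ Dn n }.

(* The fibrewise function-space structure: t |-> c t is a basic curve when its
   base point varies smoothly and (t, g) |-> c t g is smooth on the fibre product
   of the line and M ⊗ W_{D^n} over M. *)
Definition fibspace (n : nat) (B M : frolicher) (rho : B -> M) : frolicher :=
  gen_curves (fun c : R -> fibmap n rho =>
    smooth (fun t : line => base (c t)) /\
    smooth (fun z : fibprod (fun t : line => rho (base (c t))) (Dn n) =>
              c (fibprod1 z) (exist _ (fibprod2 z) (proj2_sig z)))).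

Definition pseudotangential (n : nat) (B M : frolicher) (rho : B -> M)
    (nab : fibmap n rho) : Prop :=
  [/\ smooth nab /\ (forall g, proj (nab g) = base nab),
      forall g, tmap rho (nab g) = incl g,
      forall a i g, nab (fpull (@scale_map0 n a i) g)
                    = pull (Dn n) (Dn n) (scale_map a i) (nab g),
      (* the first equation identifies (id_M ⊗ W_mu)(g) with an element u of
         (M ⊗ W_{D^n})_{rho(base)} ⊗ W_{D_m} *)
      forall m i g, exists2 u : fib n (rho (base nab)) ⊗ Dm m,
        curry (pull (Dn n) (wtensor (Dn n) (Dm m)) (mu_map i) (incl g))
        = tmap (@incl _ _) u &
        tmap nab u
        = curry (pull (Dn n) (wtensor (Dn n) (Dm m)) (mu_map i) (nab g)) &
      forall (s : 'S_n) g, nab (fpull (perm_map0 s) g)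
                           = pull (Dn n) (Dn n) (perm_map s) (nab g)].

(* d_(n+1) \o nabla \o s_(n+1) *)
Definition hatproj (n : nat) (B M : frolicher) (rho : B -> M)
    (nab : fibmap n.+1 rho) : fibmap n rho :=
  @Fibmap n B M rho (base nab) (fun g =>
    pull (Dn n.+1) (Dn n) (insert_map ord_max)
      (nab (fpull (delete_map0 ord_max) g))).

(* For n = 0 this gives E: a fibre of M ⊗ W_{D^0} is a single point. *)
Fixpoint tangential (n : nat) (E M : frolicher) (pi : E -> M) {struct n} :
    fibmap n pi -> Prop :=
  match n with
  | 0 => @pseudotangential 0 E M pi
  | n1.+1 =>
    match n1 return (fibmap n1 pi -> Prop) -> fibmap n1.+1 pi -> Prop with
    | 0 => fun _ => @pseudotangential 1 E M pi
    | n2.+1 => fun tangential_n1 nab =>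
        [/\ pseudotangential nab, tangential_n1 (hatproj nab) &
            forall g, nab (fpull (kappa_map0 n2) g)
              = pull (Dn n2.+1) (Dn n2.+2) (@kappa_map n2) (hatproj nab g)]
    end (@tangential n1 E M pi)
  end.

Definition jets (n : nat) (B M : frolicher) (rho : B -> M)
  (S : fibmap n rho -> Prop) : frolicher := @subspace (fibspace n rho) S.

Definition jbase (n : nat) (B M : frolicher) (rho : B -> M) (S : fibmap n rho -> Prop)
  (x : jets S) : B := base (incl x).

Definition jproj (n : nat) (B M : frolicher) (rho : B -> M) (S : fibmap n rho -> Prop)
  (x : jets S) : M := rho (jbase x).

Definition ev (n : nat) (B M : frolicher) (rho : B -> M) (S : fibmap n rho -> Prop)
    (z : fibprod (@jproj n B M rho S) (Dn n)) : B ⊗ Dn n :=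
  incl (fibprod1 z) (exist _ (fibprod2 z) (proj2_sig z)).

Definition JD (E M : frolicher) (pi : E -> M) (n : nat) : frolicher :=
  jets (@tangential n E M pi).

Definition JD_proj (E M : frolicher) (pi : E -> M) (n : nat) : JD pi n -> M :=
  @jproj n E M pi (@tangential n E M pi).
Arguments JD_proj {E M} pi n _.

(** * Iterated 1-tangentials *)

(* Let J = jets S be a space of 1-tangentials over rho : B -> M, and let nab be
   a 1-tangential over J -> M. [Phi nab g] is the graph of the map g |-> Phi(g):
   u is the pair (nab(t), g) seen in (J x_M (M ⊗ W_D)) ⊗ W_D, with t induced by
   d |-> (0, d). *)
Definition Phi (B M : frolicher) (rho : B -> M) (S : fibmap 1 rho -> Prop)
    (nab : fibmap 1 (@jproj 1 B M rho S))
    (g : fib 2 (jproj (base nab))) (de : B ⊗ Dn 2) : Prop :=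
  exists u : fibprod (@jproj 1 B M rho S) (Dn 1) ⊗ Dn 1,
    [/\ tmap (@fibprod1 _ _ _ _) u = nab (fpull (insert_map0 ord0) g),
        tmap (@fibprod2 _ _ _ _) u = curryD (incl g) &
        curryD de = tmap (@ev 1 B M rho S) u].

Definition compatible (B M : frolicher) (rho : B -> M) (S : fibmap 1 rho -> Prop)
    (nab : fibmap 1 (@jproj 1 B M rho S)) : Prop :=
  let s : 'S_2 := tperm ord0 ord_max in
  [/\ pseudotangential nab,
      forall t, tmap (@jbase 1 B M rho S) (nab t) = incl (base nab) t &
      forall g de, Phi g de ->
        @Phi B M rho S nab (fpull (perm_map0 s) g)
          (pull (Dn 2) (Dn 2) (perm_map s) de)].

(* A level of the tower consists of J^k, its projection to M, and the predicate
   on fibrewise maps over J^k that defines J^(k+1). *)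
Record level (M : frolicher) := Level {
  lev_space : frolicher;
  lev_proj : lev_space -> M;
  lev_pred : fibmap 1 lev_proj -> Prop }.

Definition next_level (M : frolicher) (L : level M) : level M :=
  @Level M (jets (@lev_pred M L)) (@jproj _ _ _ _ (@lev_pred M L))
    (@compatible _ _ _ (@lev_pred M L)).

Fixpoint tower (E M : frolicher) (pi : E -> M) (k : nat) : level M :=
  match k with
  | 0 => @Level M E pi (@pseudotangential 1 E M pi)
  | k1.+1 => next_level (tower pi k1)
  end.

Definition J (E M : frolicher) (pi : E -> M) (k : nat) : frolicher :=
  lev_space (tower pi k).

(* pi_k *)
Definition J_proj (E M : frolicher) (pi : E -> M) (k : nat) : J pi k -> M :=
  @lev_proj M (tower pi k).
Arguments J_proj {E M} pi k _.

(* pi_(k+1,k) *)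
Definition J_down (E M : frolicher) (pi : E -> M) (k : nat) : J pi k.+1 -> J pi k :=
  @jbase 1 _ _ _ (@lev_pred M (tower pi k)).
Arguments J_down {E M} pi k _.

(* pi_(k,0) *)
Fixpoint J_base (E M : frolicher) (pi : E -> M) (k : nat) : J pi k -> E :=
  match k with
  | 0 => id
  | k1.+1 => fun x => @J_base E M pi k1 (J_down pi k1 x)
  end.
Arguments J_base {E M} pi k _.

Definition J_fibmap (E M : frolicher) (pi : E -> M) (k : nat) (x : J pi k.+1) :
  fibmap 1 (J_proj pi k) := proj1_sig x.

Definition J_ev (E M : frolicher) (pi : E -> M) (k : nat) :
    fibprod (J_proj pi k.+1) (Dn 1) -> J pi k ⊗ Dn 1 :=
  @ev 1 _ _ _ (@lev_pred M (tower pi k)).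
Arguments J_ev {E M} pi k _.

Definition JD_ev (E M : frolicher) (pi : E -> M) (n : nat) :
    fibprod (JD_proj pi n) (Dn n) -> E ⊗ Dn n :=
  @ev n E M pi (@tangential n E M pi).
Arguments JD_ev {E M} pi n _.

(** * The mappings phi_n *)

(* [phi_value ph nab g de]: de is the value at g of phi_(n+1)(nab), where
   phi_n = ph is regarded as a map J^n -> JD^n. *)
Definition phi_value (E M : frolicher) (pi : E -> M) (n : nat)
    (ph : J pi n -> fibmap n pi) (nab : J pi n.+1)
    (g : M ⊗ Dn n.+1) (de : E ⊗ Dn n.+1) : Prop :=
  exists (ph' : J pi n -> JD pi n)
         (t : fib 1 (J_proj pi n (base (J_fibmap nab))))
         (u : fibprod (JD_proj pi n) (Dn n) ⊗ Dn 1),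
    (forall x, incl (ph' x) = ph x) /\
    [/\ incl t = tmap (@proj M (Dn n)) (curryD g),
        tmap (@fibprod1 _ _ _ _) u = tmap ph' (J_fibmap nab t),
        tmap (@fibprod2 _ _ _ _) u = curryD g &
        curryD de = tmap (JD_ev pi n) u].

Definition const_jet (X : frolicher) (W : presentation) (x : X) : X ⊗ W :=
  jet W (fun _ => x).

(* By uniqueness of u, phi_value determines the value chosen here. *)
Definition phi_next (E M : frolicher) (pi : E -> M) (n : nat)
    (ph : J pi n -> fibmap n pi) (nab : J pi n.+1) : fibmap n.+1 pi :=
  @Fibmap n.+1 E M pi (J_base pi n (J_down pi n nab)) (fun g =>
    epsilon (inhabits (const_jet (Dn n.+1) (J_base pi n (J_down pi n nab))))
      (phi_value ph nab (incl g))).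

(* J^1 is the space of D-pseudotangentials, and phi_1 is the identity; phi_0 is
   the identity of E, in the sense that x stands for the unique map between the
   one-point fibres over pi(x) and x. *)
Fixpoint phi (E M : frolicher) (pi : E -> M) (n : nat) : J pi n -> fibmap n pi :=
  match n with
  | 0 => fun x => @Fibmap 0 E M pi x (fun _ => const_jet (Dn 0) x)
  | n1.+1 =>
    match n1 return (J pi n1 -> fibmap n1 pi) -> J pi n1.+1 -> fibmap n1.+1 pi with
    | 0 => fun _ x => J_fibmap x
    | n2.+1 => fun phi_n1 => phi_next phi_n1
    end (@phi E M pi n1)
  end.
Arguments phi {E M} pi n _.

(* Main.v *)
(* Put Psi = phi_(n+1)(nabla). Under E ⊗ W_{D^(n+1)} = (E ⊗ W_{D^n}) ⊗ W_D the value
   Psi(g) is the image, under the prolonged evaluation (y, c) |-> phi_n(y)(c), of the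
   element of (J^n x_M (M ⊗ W_{D^n})) ⊗ W_D whose components are nabla(t) and g. Hence an
   operation on the first n coordinates commutes with Psi because it commutes with each
   phi_n(y), and scaling of the last coordinate because it commutes with nabla. Freezing
   the last coordinate at 0 makes nabla(t) constant, so Psi projects to phi_n(x_n). For
   g = kappa^* c, too, nabla(t) is constant, while g is the jet of e |-> e ._n c; so the
   condition on kappa is the homogeneity of phi_n(x_n). Permutations of the first n
   coordinates and the transposition of the last two generate S_(n+1); for that
   transposition the recursion is unfolded twice: under
   E ⊗ W_{D^(n+1)} = (E ⊗ W_{D^(n-1)}) ⊗ W_{D^2} the value Psi(g) is the image, under the
   prolonged evaluation of phi_(n-1), of an element with components Phi(g') and g, where
   g' in M ⊗ W_{D^2} is the restriction of g to the last two coordinates. All of this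
   commutes with the transposition since Phi does. *)

From Stdlib Require Import Reals Lra FunctionalExtensionality PropExtensionality.
From Stdlib Require Import ProofIrrelevance ClassicalEpsilon.
From mathcomp Require Import all_boot fingroup perm.
From Coquelicot Require Import Coquelicot.
Require Import Defs.

Set Implicit Arguments.
Unset Strict Implicit.
Unset Printing Implicit Defensive.

Open Scope R_scope.

(** * Differential calculus of several variables *)

(** Splitting off a coordinate of D^n rests on Weil exponentiability, which speaks of Weil algebras
    only. As these are quotients of rings of smooth functions, even [Dn] and [Dm] have to be shown
    to kill a power of the ideal of all smooth functions vanishing at 0. This is Hadamard's lemma,
    and it brings in the chain rule and integrals with parameters. The values of [phi_next] are
    selected by [epsilon] and cannot be computed. The inductive step therefore treats an arbitrary
    map [f] of which only [f_lift] is known: under [curryD], [f g] is the prolonged evaluation of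
    any pair with the right components. Since such pairs are unique and [curryD] is injective, each
    identity for [f] reduces to exhibiting a pair and comparing components. The transposition of the
    last two coordinates resists this scheme, as it mixes the coordinate consumed by nabla with one
    consumed a level below. It needs two levels of the recursion, hence a separate argument at n =
    1, where phi_1 is given outright and not by recursion. *)

Lemma filter_forall_fin (T : Type) (F : (T -> Prop) -> Prop) (K : finType)
    (P : K -> T -> Prop) :
  Filter F -> (forall j, F (P j)) -> F (fun x => forall j, P j x).
Proof.
move=> FF FP.
suff H (s : seq K) : F (fun x => forall j, j \in s -> P j x).
  by apply: filter_imp (H (enum K)) => x hx j; apply: hx; rewrite mem_enum.
elim: s => [|i s IH]; first by apply: filter_imp filter_true.
apply: filter_imp (filter_and _ _ (FP i) IH) => x [hi hs] j.
by rewrite inE => /orP [/eqP ->|/hs].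
Qed.

Lemma continuous_coord (U : UniformSpace) (K : finType) (c : U -> K -> R) x :
  (forall j, continuous (fun y => c y j) x) -> continuous c x.
Proof.
move=> hc; apply/filterlim_locally => eps.
by apply: filter_forall_fin => j; move/filterlim_locally: (hc j); exact.
Qed.

Lemma coord_continuous (K : finType) (j : K) (x : K -> R) :
  continuous (fun y : K -> R => y j) x.
Proof. by apply/filterlim_locally => eps; exists eps => y; apply. Qed.

Lemma upd_same (K : finType) (x : K -> R) i : upd x i (x i) = x.
Proof. by apply: functional_extensionality => j; rewrite /upd; case: eqP => [->|]. Qed.

Lemma upd_upd (K : finType) (x : K -> R) i a b : upd (upd x i a) i b = upd x i b.
Proof. by apply: functional_extensionality => j; rewrite /upd; case: eqP. Qed.

Lemma upd_at (K : finType) (x : K -> R) i a : upd x i a i = a.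
Proof. by rewrite /upd eqxx. Qed.

Section ChainRule.
Variables (K : finType) (f : (K -> R) -> R).
Hypothesis df : forall x i, ex_derive (fun h => f (upd x i h)) (x i).
Hypothesis cf : forall i x, continuous (pder i f) x.

Lemma is_derive_upd x i u :
  is_derive (fun h => f (upd x i h)) u (pder i f (upd x i u)).
Proof.
have := df (upd x i u) i; rewrite upd_at => /Derive_correct.
rewrite /pder upd_at.
have -> : (fun h => f (upd (upd x i u) i h)) = fun h => f (upd x i h).
  by apply: functional_extensionality => h; rewrite upd_upd.
exact.
Qed.

(** Mean value theorem in one coordinate. The bound keeps the intermediate point as close to the
    base point as the endpoint, whatever the order of [a] and [b], so that continuity of the partial
    derivative applies to it. *)
Lemma increment_upd x i a b :
  exists2 u, Rabs (u - a) <= Rabs (b - a) &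
    f (upd x i b) - f (upd x i a) = pder i f (upd x i u) * (b - a).
Proof.
have [u _|u _|u [hu ->]] :=
    @MVT_gen (fun h => f (upd x i h)) a b (fun u => pder i f (upd x i u)).
- exact: is_derive_upd.
- apply/continuity_pt_filterlim; apply: ex_derive_continuous.
  by eexists; apply: is_derive_upd.
exists u => //; move: hu; rewrite /Rmin /Rmax; case: Rle_dec => hab [h1 h2].
  by rewrite !Rabs_pos_eq; lra.
by rewrite !Rabs_left1; lra.
Qed.

(** The coordinates are set in motion one at a time: those in [s] follow [c], the others rest at
    [c t]. A new coordinate adds an increment whose partial derivative is taken near [c t], so it is
    linear up to o(h). *)
Lemma is_derive_mix (c : R -> K -> R) t (s : seq K) :
  (forall i, ex_derive (fun h => c h i) t) -> uniq s ->
  is_derive (fun h => f (fun j => if j \in s then c h j else c t j)) t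
    (\big[Rplus/0]_(i <- s) (pder i f (c t) * Derive (fun h => c h i) t)).
Proof.
move=> dc; elim: s => [|i s IH] /=.
  by move=> _; rewrite big_nil; apply: is_derive_const.
move=> /andP [nis us]; rewrite big_cons.
set a := pder i f (c t); set l := Derive _ _; set S := \big[_/_]_(_ <- _) _.
pose z h : K -> R := fun j => if j \in s then c h j else c t j.
pose E h := f (fun j => if j \in i :: s then c h j else c t j) - f (z h)
            - a * (c h i - c t i).
have dE : is_derive E t 0.
  apply/is_derive_Reals => eps eps0.
  (* For small h the difference quotient of the i-th coordinate is within 1 of [l], hence below
     [Rabs l + 2] in absolute value; the partial derivative is then kept within eps over this
     bound. *)
  have l0 : 0 < Rabs l + 2 by have := Rabs_pos l; lra.
  have e0 : 0 < eps / (Rabs l + 2) by apply: Rdiv_lt_0_compat.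
  have /filterlim_locally/(_ (mkposreal _ e0)) [d hd] := @cf i (c t).
  have cc : continuous c t.
    by apply: continuous_coord => j; apply: ex_derive_continuous.
  have /filterlim_locally/(_ d) [d1 hd1] := cc.
  have /Derive_correct/is_derive_Reals/(_ 1 Rlt_0_1) [d2 hd2] := dc i.
  have d0 : 0 < Rmin d1 d2 by apply: Rmin_pos; [apply: cond_pos|apply: cond_pos].
  exists (mkposreal _ d0) => h h0 /= hh.
  have [hh1 hh2] : Rabs h < d1 /\ Rabs h < d2.
    by have := Rmin_l d1 d2; have := Rmin_r d1 d2; lra.
  have cth : forall j, Rabs (c (t + h) j - c t j) < d.
    move=> j; have := hd1 (t + h) _ j; apply.
    rewrite /ball /= /AbsRing_ball /abs /minus /plus /opp /=.
    by rewrite (_ : t + h + - t = h); [|lra].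
  have [u hu eu] := increment_upd (z (t + h)) i (c t i) (c (t + h) i).
  have -> : E (t + h) = (pder i f (upd (z (t + h)) i u) - a) * (c (t + h) i - c t i).
    rewrite Rmult_minus_distr_r -eu /E; congr (_ - _); congr (f _ - f _);
      apply: functional_extensionality => j; rewrite /upd /z ?inE; case: eqP => // -> //.
    by rewrite (negbTE nis).
  have -> : E t = 0.
    have mixt (s' : seq K) : (fun j => if j \in s' then c t j else c t j) = c t.
      by apply: functional_extensionality => j; case: ifP.
    by rewrite /E /z !mixt Rminus_diag Rminus_diag Rmult_0_r Rminus_diag.
  have {hd2} := hd2 h h0 hh2; rewrite -/l => hl.
  have pa : Rabs (pder i f (upd (z (t + h)) i u) - a) < eps / (Rabs l + 2).
    apply: hd => j; rewrite /ball /= /AbsRing_ball /abs /minus /plus /opp /=.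
    rewrite /upd /z; case: eqP => [->|_]; first by apply: Rle_lt_trans hu (cth i).
    case: ifP => _; first exact: cth.
    by rewrite (_ : c t j + - c t j = 0) ?Rabs_R0; [apply: cond_pos|lra].
  rewrite (_ : _ - 0 = (pder i f (upd (z (t + h)) i u) - a) *
                       ((c (t + h) i - c t i) / h)); last by field.
  rewrite Rabs_mult.
  have hq : Rabs ((c (t + h) i - c t i) / h) < Rabs l + 2.
    have -> : (c (t + h) i - c t i) / h = ((c (t + h) i - c t i) / h - l) + l by lra.
    by apply: Rle_lt_trans (Rabs_triang _ _) _; lra.
  have -> : eps = eps / (Rabs l + 2) * (Rabs l + 2) by field; lra.
  by apply: Rmult_le_0_lt_compat => //; apply: Rabs_pos.
have dl : is_derive (fun h => a * (c h i - c t i)) t (a * l).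
  apply: is_derive_scal; rewrite -[l]Rminus_0_r.
  by apply: (@is_derive_minus R_AbsRing R_NormedModule (fun h => c h i) (fun _ => c t i));
    [apply: Derive_correct|apply: is_derive_const].
have := is_derive_plus _ _ _ _ _ (is_derive_plus _ _ _ _ _ dl dE) (IH us).
rewrite /plus /= Rplus_0_r; apply: is_derive_ext => h.
have cancel (p q r : R) : p + (q - r - p) + r = q by ring.
exact: cancel.
Qed.

Lemma is_derive_chain (c : R -> K -> R) t :
  (forall i, ex_derive (fun h => c h i) t) ->
  is_derive (fun h => f (c h)) t
    (\big[Rplus/0]_(i <- enum K) (pder i f (c t) * Derive (fun h => c h i) t)).
Proof.
move=> dc; apply: is_derive_ext (is_derive_mix dc (enum_uniq _)) => h.
by congr f; apply: functional_extensionality => j; rewrite mem_enum.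
Qed.

End ChainRule.

Lemma Cinf_continuous (K : finType) (f : (K -> R) -> R) x : Cinf f -> continuous f x.
Proof. by move/(_ [::] x) => []. Qed.

Lemma Cinf_derive (K : finType) (f : (K -> R) -> R) x i :
  Cinf f -> ex_derive (fun h => f (upd x i h)) (x i).
Proof. by move/(_ [::] x) => [_]; apply. Qed.

Lemma Cinf_pder (K : finType) (f : (K -> R) -> R) i : Cinf f -> Cinf (pder i f).
Proof. by move=> hf s x; have := hf (rcons s i) x; rewrite foldr_rcons. Qed.

Lemma Cinf_chain (K : finType) (f : (K -> R) -> R) (c : R -> K -> R) t : Cinf f ->
  (forall i, ex_derive (fun h => c h i) t) ->
  is_derive (fun h => f (c h)) t
    (\big[Rplus/0]_(i <- enum K) (pder i f (c t) * Derive (fun h => c h i) t)).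
Proof.
move=> hf; apply: is_derive_chain => [x i|i x]; first exact: Cinf_derive.
exact/Cinf_continuous/Cinf_pder.
Qed.

(** [Cinf] is the largest class of continuous, partially differentiable functions stable under
    [pder]; smoothness is proved below by exhibiting a stable class. *)
Lemma Cinf_coind (K : finType) (P : ((K -> R) -> R) -> Prop) :
  (forall f, P f -> [/\ forall x, continuous f x,
     forall x i, ex_derive (fun h => f (upd x i h)) (x i) & forall i, P (pder i f)]) ->
  forall f, P f -> Cinf f.
Proof.
move=> hP f Pf s x; have : P (foldr (@pder K) f s).
  by elim: s => //= i s IH; case: (hP _ IH).
by case/hP => h1 h2 _; split.
Qed.

(* Composition is built in because partial derivatives of f \o th are not of that form,
   whereas this class is stable under them. *)
Inductive Cinf_closure (K : finType) : ((K -> R) -> R) -> Prop :=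
| CC_base f : Cinf f -> Cinf_closure f
| CC_const a : Cinf_closure (fun _ => a)
| CC_coord i : Cinf_closure (fun x => x i)
| CC_plus f g : Cinf_closure f -> Cinf_closure g -> Cinf_closure (fun x => f x + g x)
| CC_mult f g : Cinf_closure f -> Cinf_closure g -> Cinf_closure (fun x => f x * g x)
| CC_comp (K' : finType) (f : (K' -> R) -> R) (th : K' -> (K -> R) -> R) :
    Cinf f -> (forall j, Cinf_closure (th j)) ->
    Cinf_closure (fun x => f (fun j => th j x)).

Lemma CC_sum (K : finType) (I : Type) (s : seq I) (F : I -> (K -> R) -> R) :
  (forall i, Cinf_closure (F i)) ->
  Cinf_closure (fun x => \big[Rplus/0]_(i <- s) F i x).
Proof.
move=> hF; elim: s => [|i s IH].
  rewrite (_ : (fun x => _) = fun _ => 0); first exact: CC_const.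
  by apply: functional_extensionality => x; rewrite big_nil.
rewrite (_ : (fun x => _) = fun x => F i x + \big[Rplus/0]_(j <- s) F j x).
  exact: CC_plus.
by apply: functional_extensionality => x; rewrite big_cons.
Qed.

Lemma CC_Cinf (K : finType) (f : (K -> R) -> R) : Cinf_closure f -> Cinf f.
Proof.
apply: Cinf_coind => {}f.
elim=> {f} [f hf|a|k|f g _ [cf df pf] _ [cg dg pg]|f g Hf [cf df pf] Hg [cg dg pg]
           |K' f th hf Hth IH].
- split=> [x|x i|i]; first exact: Cinf_continuous.
    exact: Cinf_derive.
  exact/CC_base/Cinf_pder.
- split=> [x|x i|i]; first exact: continuous_const.
    exact: ex_derive_const.
  rewrite (_ : pder i _ = fun _ => 0); first exact: CC_const.
  by apply: functional_extensionality => x; apply: Derive_const.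
- split=> [x|x i|i]; first exact: coord_continuous.
    rewrite /upd; case: eqP => _; [exact: ex_derive_id|exact: ex_derive_const].
  rewrite (_ : pder i _ = fun _ => if k == i then 1 else 0); first exact: CC_const.
  apply: functional_extensionality => x; rewrite /pder /upd; case: eqP => _.
    exact: Derive_id.
  exact: Derive_const.
- split=> [x|x i|i]; first exact: continuous_plus.
    exact: ex_derive_plus.
  rewrite (_ : pder i _ = fun x => pder i f x + pder i g x); first exact: CC_plus.
  by apply: functional_extensionality => x; apply: Derive_plus.
- split=> [x|x i|i]; first exact: continuous_mult.
    exact: ex_derive_mult.
  rewrite (_ : pder i _ = fun x => pder i f x * g x + f x * pder i g x).
    by apply: CC_plus; apply: CC_mult.
  apply: functional_extensionality => x; rewrite /pder Derive_mult //.
  by rewrite !upd_same.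
- have dth x i j : ex_derive (fun h => th j (upd x i h)) (x i) by case: (IH j).
  split=> [x|x i|i].
  + apply: (@continuous_comp _ _ _ (fun x j => th j x) f).
      by apply: continuous_coord => j; case: (IH j).
    exact: Cinf_continuous.
  + by eexists; apply: (Cinf_chain (c := fun h j => th j (upd x i h)) hf).
  + rewrite (_ : pder i _ = fun x => \big[Rplus/0]_(j <- enum K')
       (pder j f (fun k => th k x) * pder i (th j) x)).
      apply: CC_sum => j; apply: CC_mult; first exact/CC_comp/Hth/Cinf_pder.
      by case: (IH j).
    apply: functional_extensionality => x; rewrite /pder; apply: is_derive_unique.
    have := Cinf_chain (c := fun h j => th j (upd x i h)) hf (dth x i).
    by rewrite upd_same.
Qed.

Lemma Cinf_const (K : finType) a : Cinf (fun _ : K -> R => a).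
Proof. exact/CC_Cinf/CC_const. Qed.

Lemma Cinf_coord (K : finType) (i : K) : Cinf (fun x => x i).
Proof. exact/CC_Cinf/CC_coord. Qed.

Lemma Cinf_plus (K : finType) (f g : (K -> R) -> R) :
  Cinf f -> Cinf g -> Cinf (fun x => f x + g x).
Proof. by move=> hf hg; apply/CC_Cinf/CC_plus; apply: CC_base. Qed.

Lemma Cinf_mult (K : finType) (f g : (K -> R) -> R) :
  Cinf f -> Cinf g -> Cinf (fun x => f x * g x).
Proof. by move=> hf hg; apply/CC_Cinf/CC_mult; apply: CC_base. Qed.

Definition Cinf_map (K K' : finType) (th : (K -> R) -> K' -> R) :=
  forall j, Cinf (fun x => th x j).

Lemma Cinf_comp (K K' : finType) (f : (K' -> R) -> R) (th : (K -> R) -> K' -> R) :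
  Cinf f -> Cinf_map th -> Cinf (fun x => f (th x)).
Proof.
by move=> hf hth; apply: CC_Cinf; apply: (@CC_comp _ _ f (fun j x => th x j)) => // j;
  apply: CC_base.
Qed.

Lemma Cinf_pow (K : finType) (f : (K -> R) -> R) n : Cinf f -> Cinf (fun x => f x ^ n).
Proof.
move=> hf; elim: n => [|n IH] /=; first exact: Cinf_const.
exact: Cinf_mult.
Qed.

Lemma Cinf_sum (K : finType) (I : Type) (s : seq I) (F : I -> (K -> R) -> R) :
  (forall i, Cinf (F i)) -> Cinf (fun x => \big[Rplus/0]_(i <- s) F i x).
Proof. by move=> hF; apply/CC_Cinf/CC_sum => i; apply: CC_base. Qed.

Lemma smoothR_ex (g : R -> R) x : smoothR g -> ex_derive g x.
Proof. by move/(_ 1%N x). Qed.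

Lemma smoothR_Derive (g : R -> R) : smoothR g -> smoothR (Derive g).
Proof.
move=> hg n x; have := hg n.+1 x.
case: n => //= n; apply: ex_derive_ext => y; clear.
elim: n y => //= n IH y; by apply: Derive_ext.
Qed.

Lemma Cinf_smoothR (K : finType) (f : (K -> R) -> R) (c : R -> K -> R) :
  Cinf f -> (forall i, smoothR (fun t => c t i)) -> smoothR (fun t => f (c t)).
Proof.
move=> hf hc n x.
(* The index type varies within the class: by the chain rule the derivative of f along c is a smooth
   function along the curve (c, c'), which has twice as many coordinates. *)
pose P g := exists (K : finType) f (c : R -> K -> R),
  [/\ Cinf f, forall i, smoothR (fun t => c t i) & g = fun t => f (c t)].
have Pd g : P g -> (forall x, ex_derive g x) /\ P (Derive g).
  move=> [K1 [f1 [c1 [hf1 hc1 ->]]]]; split.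
    move=> y; eexists; apply: (Cinf_chain (c := c1) hf1) => i.
    exact: smoothR_ex.
  exists (K1 + K1)%type, (fun z => \big[Rplus/0]_(i <- enum K1)
     (pder i f1 (fun j => z (inl j)) * z (inr i))),
    (fun t k => match k with inl i => c1 t i | inr i => Derive (fun h => c1 h i) t end).
  split.
  - apply: Cinf_sum => i; apply: Cinf_mult; last exact: Cinf_coord.
    apply: (@Cinf_comp _ _ (pder i f1) (fun z j => z (inl j))); first exact: Cinf_pder.
    by move=> j; apply: Cinf_coord.
  - by case=> i //; apply: smoothR_Derive.
  - apply: functional_extensionality => t; apply: is_derive_unique.
    by apply: (Cinf_chain (c := c1) hf1) => i; apply: smoothR_ex.
have Pn g m : P g -> P (Derive_n g m) by elim: m => //= m IH /IH /Pd [].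
have Pg : P (fun t => f (c t)) by exists K, f, c.
by case: n => [|n] //=; case: (Pd _ (Pn _ n Pg)).
Qed.

(** * Hadamard's lemma and Weil algebras *)

(** The integration variable becomes one more coordinate, so joint smoothness of an integrand is
    again an instance of [Cinf]. *)
Definition extend (K : Type) (x : K -> R) (t : R) : option K -> R :=
  fun o => if o is Some k then x k else t.

Lemma extend_upd (K : finType) (x : K -> R) i u t :
  extend (upd x i u) t = upd (extend x t) (Some i) u.
Proof. by apply: functional_extensionality => -[k|]. Qed.

Lemma pder_extend (K : finType) (F : (option K -> R) -> R) x i u t :
  Derive (fun z => F (extend (upd x i z) t)) u = pder (Some i) F (extend (upd x i u) t).
Proof.
rewrite /pder; have -> : extend (upd x i u) t (Some i) = u by apply: upd_at.
by apply: Derive_ext => z; rewrite !extend_upd upd_upd.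
Qed.

Lemma ex_RInt_extend (K : finType) (F : (option K -> R) -> R) x a b :
  Cinf F -> ex_RInt (fun t => F (extend x t)) a b.
Proof.
move=> hF; apply: (@ex_RInt_continuous R_CompleteNormedModule) => t _.
apply: (@continuous_comp _ _ _ (fun t => extend x t) F); last exact: Cinf_continuous.
apply: continuous_coord => -[k|] /=; [exact: continuous_const|exact: continuous_id].
Qed.

Lemma is_derive_RInt_extend (K : finType) (F : (option K -> R) -> R) (x : K -> R) i :
  Cinf F ->
  is_derive (fun h => RInt (fun t => F (extend (upd x i h) t)) 0 1) (x i)
    (RInt (fun t => pder (Some i) F (extend x t)) 0 1).
Proof.
move=> hF.
have -> : (fun t => pder (Some i) F (extend x t)) =
          fun t => Derive (fun z => F (extend (upd x i z) t)) (x i).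
  by apply: functional_extensionality => t; rewrite pder_extend upd_same.
apply: (@is_derive_RInt_param (fun u t => F (extend (upd x i u) t))).
- apply: filter_forall => u t _.
  have := Cinf_derive (upd (extend x t) (Some i) u) (Some i) hF.
  rewrite upd_at; apply: ex_derive_ext => z.
  by rewrite upd_upd extend_upd.
- move=> t _; apply/continuity_2d_pt_filterlim.
  rewrite (_ : (fun z => _) = fun z : R * R => pder (Some i) F (extend (upd x i z.1) z.2)).
    rewrite pder_extend.
    change (continuous (fun z : R * R => pder (Some i) F (extend (upd x i z.1) z.2)) (x i, t)).
    apply: (@continuous_comp _ _ _ (fun z : R * R => extend (upd x i z.1) z.2) (pder (Some i) F)).
      apply: continuous_coord => -[k|] /=; last exact: continuous_snd.
      rewrite /upd; case: eqP => _; [exact: continuous_fst|exact: continuous_const].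
    exact/Cinf_continuous/Cinf_pder.
  by apply: functional_extensionality => -[u v]; rewrite pder_extend.
- by apply: filter_forall => u; apply: ex_RInt_extend.
Qed.

Lemma continuous_RInt_extend (K : finType) (F : (option K -> R) -> R) (x0 : K -> R) :
  Cinf F -> continuous (fun x : K -> R => RInt (fun t => F (extend x t)) 0 1) x0.
Proof.
move=> hF; apply/filterlim_locally => eps.
have e3 : 0 < eps / 3 by have := cond_pos eps; lra.
have H t : {d : posreal | forall y : option K -> R,
    (forall o, Rabs (y o - extend x0 t o) < d) -> Rabs (F y - F (extend x0 t)) < eps / 3}.
  apply: constructive_indefinite_description.
  have /filterlim_locally/(_ (mkposreal _ e3)) [d hd] := @Cinf_continuous _ F (extend x0 t) hF.
  by exists d => y hy; apply: hd => o; apply: hy.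
(* Compactness of [0, 1] gives a uniform radius: each t lies within the radius of some s, and that
   radius is at least [d]. Existence of s is only given doubly negated, whence [NNPP] below. *)
have [d hd] := compactness_value_1d 0 1 (fun t => proj1_sig (H t)).
exists d => x hx; have {}hx k : Rabs (x k - x0 k) < d by apply: hx.
rewrite /ball /= /AbsRing_ball /abs /=.
have -> : minus (RInt (fun t => F (extend x t)) 0 1) (RInt (fun t => F (extend x0 t)) 0 1) =
          RInt (fun t => minus (F (extend x t)) (F (extend x0 t))) 0 1.
  by rewrite RInt_minus //; apply: ex_RInt_extend.
(* Both integrands are compared with the value at the same point [extend x0 s], at a cost of eps / 3
   each. *)
apply: Rle_lt_trans (_ : (1 - 0) * (2 * (eps / 3)) < eps); last first.
  by have := cond_pos eps; lra.
apply: abs_RInt_le_const; first by lra.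
  by apply: (@ex_RInt_minus R_NormedModule); apply: ex_RInt_extend.
move=> t ht; apply: NNPP => hn; apply: (hd t ht) => -[s [hs [hts]]].
case: (H s) hts => ds /= hds hts hd'; apply: hn.
have /hds h1 : forall o, Rabs (extend x t o - extend x0 s o) < ds.
  by case=> [k|] //=; apply: Rlt_le_trans (hx k) _.
have /hds h2 : forall o, Rabs (extend x0 t o - extend x0 s o) < ds.
  case=> [k|] //=; rewrite Rminus_diag Rabs_R0; exact: cond_pos.
rewrite /minus /plus /opp /=.
have -> : F (extend x t) + - F (extend x0 t) =
  (F (extend x t) - F (extend x0 s)) + - (F (extend x0 t) - F (extend x0 s)) by ring.
by apply: Rle_trans (Rabs_triang _ _) _; rewrite Rabs_Ropp; lra.
Qed.

Lemma Cinf_RInt (K : finType) (F : (option K -> R) -> R) :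
  Cinf F -> Cinf (fun x : K -> R => RInt (fun t => F (extend x t)) 0 1).
Proof.
move=> hF; pose P g := exists2 F : (option K -> R) -> R, Cinf F &
  g = fun x : K -> R => RInt (fun t => F (extend x t)) 0 1.
apply: (@Cinf_coind _ P); last by exists F.
move=> g [{hF}F hF ->]; split.
- by move=> x; apply: continuous_RInt_extend.
- by move=> x i; eexists; apply: is_derive_RInt_extend.
- move=> i; exists (pder (Some i) F); first exact: Cinf_pder.
  apply: functional_extensionality => x.
  by apply: is_derive_unique; apply: is_derive_RInt_extend.
Qed.

Lemma is_RInt_sum (I : Type) (s : seq I) (F : I -> R -> R) (l : I -> R) a b :
  (forall i, is_RInt (F i) a b (l i)) ->
  is_RInt (fun t => \big[Rplus/0]_(i <- s) F i t) a b (\big[Rplus/0]_(i <- s) l i).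
Proof.
move=> hF; elim: s => [|i s IH].
  rewrite big_nil (_ : (fun t => _) = fun _ => 0).
    have := @is_RInt_const R_NormedModule a b 0.
    by rewrite /scal /= /mult /= Rmult_0_r.
  by apply: functional_extensionality => x; rewrite big_nil.
rewrite big_cons (_ : (fun t => _) = fun x => F i x + \big[Rplus/0]_(j <- s) F j x).
  exact: (@is_RInt_plus R_NormedModule).
by apply: functional_extensionality => x; rewrite big_cons.
Qed.

(** As f vanishes at 0, f(x) is the integral over [0, 1] of the derivative of t |-> f(t x); the
    factor of x_i is the integral of the i-th partial derivative at t x. *)
Lemma hadamard (K : finType) (f : (K -> R) -> R) : maxideal f ->
  exists2 g : K -> (K -> R) -> R, forall i, Cinf (g i) &
    forall x, f x = \big[Rplus/0]_(i <- enum K) (x i * g i x).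
Proof.
move=> [hf f0].
pose F i (z : option K -> R) := pder i f (fun j => z None * z (Some j)).
have hF i : Cinf (F i).
  apply: (@Cinf_comp _ _ (pder i f) (fun z j => z None * z (Some j))); first exact: Cinf_pder.
  by move=> j; apply: Cinf_mult; apply: Cinf_coord.
exists (fun i x => RInt (fun t => F i (extend x t)) 0 1) => [i|x]; first exact: Cinf_RInt.
have D t : is_derive (fun t => f (fun j => t * x j)) t
    (\big[Rplus/0]_(i <- enum K) (x i * F i (extend x t))).
  have := Cinf_chain (c := fun t j => t * x j) (t := t) hf.
  rewrite (_ : \big[_/_]_(_ <- _) _ = \big[Rplus/0]_(i <- enum K) (x i * F i (extend x t))).
    by apply=> i; apply: ex_derive_mult; [exact: ex_derive_id|exact: ex_derive_const].
  apply: eq_bigr => i _; rewrite Rmult_comm; congr (_ * _).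
  by rewrite Derive_mult ?Derive_id ?Derive_const;
    [ring|exact: ex_derive_id|exact: ex_derive_const].
have I1 : is_RInt (fun t => \big[Rplus/0]_(i <- enum K) (x i * F i (extend x t))) 0 1
  (\big[Rplus/0]_(i <- enum K) (x i * RInt (fun t => F i (extend x t)) 0 1)).
  apply: is_RInt_sum => i; apply: (@is_RInt_scal R_NormedModule).
  exact/(@RInt_correct R_CompleteNormedModule)/ex_RInt_extend.
have I2 := @is_RInt_derive R_CompleteNormedModule (fun t => f (fun j => t * x j)) _ 0 1
  (fun t _ => D t).
have {}I2 := is_RInt_unique _ _ _ _ (I2 _).
rewrite -(is_RInt_unique _ _ _ _ I1) I2.
  rewrite /minus /plus /opp /=.
  have -> : (fun j => 1 * x j) = x by apply: functional_extensionality => j; ring.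
  have -> : (fun j => 0 * x j) = origin by apply: functional_extensionality => j; rewrite Rmult_0_l.
  by rewrite f0 Ropp_0 Rplus_0_r.
move=> t _.
apply: (@continuous_comp _ _ _ (fun t => extend x t)
  (fun z => \big[Rplus/0]_(i <- enum K) (x i * F i z))).
  apply: continuous_coord => -[k|] /=; [exact: continuous_const|exact: continuous_id].
apply/Cinf_continuous/Cinf_sum => i; apply: Cinf_mult => //; exact: Cinf_const.
Qed.

Lemma ideal_sum (W : presentation) (I : Type) (s : seq I) (F : I -> (idx W -> R) -> R) :
  (forall i, ideal W (F i)) -> ideal W (fun x => \big[Rplus/0]_(i <- s) F i x).
Proof.
case: (ideal_closed W) => h0 hD _ hF; elim: s => [|i s IH].
  rewrite (_ : (fun t => _) = fun _ => 0) //.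
  by apply: functional_extensionality => x; rewrite big_nil.
rewrite (_ : (fun t => _) = fun x => F i x + \big[Rplus/0]_(j <- s) F j x).
  exact: hD.
by apply: functional_extensionality => x; rewrite big_cons.
Qed.

(* By Hadamard's lemma a factor in the maximal ideal can be traded for a coordinate. *)
Lemma weil_of_monomials (W : presentation) (r : nat) :
  (forall f, ideal W f -> maxideal f) ->
  (forall s : seq (idx W), (r <= size s)%N ->
     ideal W (fun x => \big[Rmult/1]_(i <- s) x i)) ->
  weil W.
Proof.
move=> hm hs; split=> //; exists r => f hf.
have [_ _ hM] := ideal_closed W.
suff H m (h : 'I_m -> (idx W -> R) -> R) (s : seq (idx W)) : (forall j, maxideal (h j)) ->
    (r <= size s + m)%N ->
    ideal W (fun x => \big[Rmult/1]_(i <- s) x i * \big[Rmult/1]_(j < m) h j x).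
  have := H r f [::] hf (leqnn r); congr (ideal W _).
  by apply: functional_extensionality => x; rewrite big_nil Rmult_1_l.
elim: m h s => [|m IH] h s hh hsz.
  rewrite addn0 in hsz; have := hs s hsz; congr (ideal W _).
  by apply: functional_extensionality => x; rewrite big_ord0 Rmult_1_r.
have [g hg eg] := hadamard (hh ord0).
have := @ideal_sum W (idx W) (enum (idx W)) (fun i x => g i x *
  (\big[Rmult/1]_(k <- i :: s) x k * \big[Rmult/1]_(j < m) h (lift ord0 j) x)).
move=> H; have {H} := H (fun i => hM _ _ (hg i) (IH _ (i :: s) (fun j => hh _) _)).
move=> H; have {H} : ideal W _ := H (fun _ => _).
rewrite /= addSn -addnS => /(_ (fun _ => hsz)).
congr (ideal W _); apply: functional_extensionality => x.
rewrite big_ord_recl eg; elim: (enum _) => [|i e IHe]; first by rewrite !big_nil; ring.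
have alg (a b c d p : R) : a * (b * c * d) + c * (p * d) = c * ((b * a + p) * d) by ring.
by rewrite !big_cons IHe; apply: alg.
Qed.

(** * Nilpotency: [Dn] and [Dm] are Weil algebras *)

Lemma gen_ideal_sub (K : finType) (G : ((K -> R) -> R) -> Prop) f : G f -> gen_ideal G f.
Proof. by move=> Gf I _ _; apply. Qed.

Lemma closed_Cinf (K : finType) : closed_ideal (@Cinf K).
Proof. by split=> [|f g|a f]; [exact: Cinf_const|exact: Cinf_plus|exact: Cinf_mult]. Qed.

Lemma closed_maxideal (K : finType) : closed_ideal (@maxideal K).
Proof.
split=> [|f g [hf f0] [hg g0]|a f ha [hf f0]]; split => //.
- exact: Cinf_const.
- exact: Cinf_plus.
- by rewrite f0 g0 Rplus_0_r.
- exact: Cinf_mult.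
- by rewrite f0 Rmult_0_r.
Qed.

Lemma gen_ideal_maxideal (K : finType) (G : ((K -> R) -> R) -> Prop) f :
  (forall k, G k -> maxideal k) -> gen_ideal G f -> maxideal f.
Proof. by move=> hG; apply=> //; [exact: closed_maxideal|move=> k []]. Qed.

Lemma Cinf_monomial (K : finType) (s : seq K) : Cinf (fun x => \big[Rmult/1]_(i <- s) x i).
Proof.
elim: s => [|i s IH].
  rewrite (_ : (fun t => _) = fun _ => 1); first exact: Cinf_const.
  by apply: functional_extensionality => x; rewrite big_nil.
rewrite (_ : (fun t => _) = fun x => x i * \big[Rmult/1]_(j <- s) x j).
  by apply: Cinf_mult => //; apply: Cinf_coord.
by apply: functional_extensionality => x; rewrite big_cons.
Qed.

Lemma monomial_rem (K : finType) (s : seq K) i x : i \in s ->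
  \big[Rmult/1]_(j <- s) x j = x i * \big[Rmult/1]_(j <- rem i s) x j.
Proof.
elim: s => //= j s IH; rewrite inE big_cons eq_sym; case: eqP => [->|_] //= hi.
by rewrite big_cons IH //; ring.
Qed.

Lemma not_uniq_monomial (K : finType) (s : seq K) : ~~ uniq s ->
  exists i s', forall x, \big[Rmult/1]_(j <- s) x j = \big[Rmult/1]_(j <- s') x j * x i ^ 2.
Proof.
elim: s => //= i s IH; rewrite negb_and negbK => /orP [his|/IH [k [s' e]]].
  have alg (a b : R) : a * (a * b) = b * (a * (a * 1)) by ring.
  by exists i, (rem i s) => x; rewrite big_cons (monomial_rem _ his); apply: alg.
by exists k, (i :: s') => x; rewrite !big_cons e; ring.
Qed.

(** By the pigeonhole principle a monomial of degree n + 1 in n coordinates repeats one, so a square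
    divides it. *)
Lemma weil_Dn n : weil (Dn n).
Proof.
apply: (@weil_of_monomials _ n.+1) => [f|s hs].
  apply: gen_ideal_maxideal => k [i ->]; split; last by rewrite /origin /=; ring.
  exact/Cinf_pow/Cinf_coord.
have [_ _ hM] := ideal_closed (Dn n).
have : ~~ uniq s.
  apply/negP => /card_uniqP us; move: hs; rewrite -us => hs.
  by have := max_card (mem s); rewrite card_ord leqNgt hs.
move=> /not_uniq_monomial [i [s' e]].
rewrite (_ : (fun x => _) = fun x : 'I_n -> R => \big[Rmult/1]_(j <- s') x j * x i ^ 2).
  by apply: hM; [exact: Cinf_monomial|apply: gen_ideal_sub; exists i].
exact: functional_extensionality.
Qed.

Lemma weil_Dm m : weil (Dm m).
Proof.
apply: (@weil_of_monomials _ m.+1) => [f|s hs].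
  apply: gen_ideal_maxideal => k ->; split; last by rewrite /origin /=; ring.
  exact/Cinf_pow/Cinf_coord.
have [_ _ hM] := ideal_closed (Dm m).
rewrite (_ : (fun x => _) = fun x : 'I_1 -> R => x ord0 ^ (size s - m.+1) * x ord0 ^ m.+1).
  apply: hM; first exact/Cinf_pow/Cinf_coord.
  exact: gen_ideal_sub.
apply: functional_extensionality => x; rewrite -pow_add.
rewrite (_ : (_ + _)%coq_nat = size s); last exact: subnK.
by elim: (s : seq 'I_1) => [|i s' IH]; rewrite ?big_nil ?big_cons ?IH ?(ord1 i).
Qed.

Lemma smooth_id (X : frolicher) : smooth (fun x : X => x).
Proof. by []. Qed.

(** * Frölicher spaces and Weil prolongation *)

Lemma smooth_comp (X Y Z : frolicher) (g : Y -> Z) (f : X -> Y) :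
  smooth g -> smooth f -> smooth (fun x => g (f x)).
Proof. by move=> sg sf c /sf /sg. Qed.

Lemma scalar_comp (X Y : frolicher) (h : Y -> R) (f : X -> Y) :
  scalar h -> smooth f -> scalar (fun x => h (f x)).
Proof. by move=> hh sf; apply/scalarP => c /sf /curveP; apply. Qed.

Lemma smooth_scalars (X Y : frolicher) (f : X -> Y) :
  (forall h, scalar h -> scalar (fun x => h (f x))) -> smooth f.
Proof. by move=> hf c hc; apply/curveP => h /hf /scalarP; apply. Qed.

Lemma smooth_gen_scalars (X : frolicher) (T : Type) (F : (T -> R) -> Prop)
    (f : X -> gen_scalars F) :
  (forall h, F h -> scalar (fun x => h (f x))) -> smooth f.
Proof. by move=> hf c hc h Fh; move/scalarP: (hf h Fh); apply. Qed.

Lemma scalar_gen (T : Type) (F : (T -> R) -> Prop) h : F h -> @scalar (gen_scalars F) h.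
Proof. by move=> Fh c; apply. Qed.

Lemma smooth_gen_curves (Y : frolicher) (T : Type) (C : (R -> T) -> Prop)
    (f : gen_curves C -> Y) :
  (forall c, C c -> curve (fun t => f (c t))) -> smooth f.
Proof.
move=> hf c hc; apply/curveP => h hh; apply: (hc (fun x => h (f x))) => c' Cc'.
by move/curveP: (hf _ Cc'); apply.
Qed.

Lemma curve_gen (T : Type) (C : (R -> T) -> Prop) c : C c -> @curve (gen_curves C) c.
Proof. by move=> Cc h; apply. Qed.

Lemma scalar_Cinf (X : frolicher) (K : finType) (f : (K -> R) -> R) (u : X -> K -> R) :
  Cinf f -> (forall i, scalar (fun x => u x i)) -> scalar (fun x => f (u x)).
Proof.
move=> hf hu; apply/scalarP => c hc; apply: (Cinf_smoothR (c := fun t => u (c t))) => // i.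
by move/scalarP: (hu i); apply.
Qed.

Lemma scalar_mult (X : frolicher) (f g : X -> R) :
  scalar f -> scalar g -> scalar (fun x => f x * g x).
Proof.
move=> hf hg; apply: (@scalar_Cinf X _ (fun z : bool -> R => z true * z false)
  (fun x b => if b then f x else g x)); last by case.
by apply: Cinf_mult; apply: Cinf_coord.
Qed.

Lemma smooth_Rn (X : frolicher) (K : Type) (f : X -> Rn K) :
  (forall i, scalar (fun x => f x i)) -> smooth f.
Proof. by move=> hf; apply: smooth_gen_scalars => _ [i ->]. Qed.

Lemma scalar_coord (K : Type) (i : K) : @scalar (Rn K) (fun x => x i).
Proof. by apply: scalar_gen; exists i. Qed.

Lemma smooth_Cinf_map (K K' : finType) (th : (K -> R) -> K' -> R) :
  Cinf_map th -> smooth (th : Rn K -> Rn K').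
Proof.
move=> hth; apply: smooth_Rn => j.
exact: (@scalar_Cinf (Rn K) K (fun x => th x j) id (hth j) (@scalar_coord K)).
Qed.

Lemma smooth_fst (X Y : frolicher) : smooth (fun z : product X Y => z.1).
Proof. by apply: smooth_scalars => h hh; apply: scalar_gen; left; exists h. Qed.

Lemma smooth_snd (X Y : frolicher) : smooth (fun z : product X Y => z.2).
Proof. by apply: smooth_scalars => h hh; apply: scalar_gen; right; exists h. Qed.

Lemma smooth_pair (Z X Y : frolicher) (f : Z -> X) (g : Z -> Y) :
  smooth f -> smooth g -> smooth (fun z => (f z, g z) : product X Y).
Proof.
move=> sf sg; apply: smooth_gen_scalars => h [] [k hk ->] /=; exact: scalar_comp.
Qed.

Lemma smooth_incl (X : frolicher) (P : X -> Prop) : smooth (@incl X P).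
Proof. by apply: smooth_scalars => h hh; apply: scalar_gen; exists h. Qed.

Lemma smooth_sub (X Y : frolicher) (P : X -> Prop) (f : Y -> subspace P) :
  smooth (fun y => incl (f y)) -> smooth f.
Proof. by move=> sf; apply: smooth_gen_scalars => h [k hk ->]; apply: (scalar_comp hk sf). Qed.

Lemma incl_inj (X : frolicher) (P : X -> Prop) (z z' : subspace P) : incl z = incl z' -> z = z'.
Proof.
by case: z z' => [x Px] [y Py] /= e; subst y; rewrite (proof_irrelevance _ Px Py).
Qed.

Lemma smoothR_Cinf (K : finType) (i : K) (g : R -> R) :
  smoothR g -> Cinf (fun x : K -> R => g (x i)).
Proof.
move=> hg; pose P f := exists2 g, smoothR g & f = fun x : K -> R => g (x i).
(* The zero function is adjoined because the partial derivatives in the other coordinates vanish. *)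
pose P0 f := P f \/ f = fun _ : K -> R => 0.
apply: (@Cinf_coind _ P0); last by left; exists g.
move=> f [[{hg}g hg ->]|->]; split.
- move=> x; apply: continuous_comp; first exact: coord_continuous.
  exact/(@ex_derive_continuous R_AbsRing R_NormedModule)/smoothR_ex.
- move=> x j; rewrite /upd; case: eqP => [<-|_]; first exact: smoothR_ex.
  exact: ex_derive_const.
- move=> j; case: (@eqP _ j i) => [->|ji].
    left; exists (Derive g); first exact: smoothR_Derive.
    apply: functional_extensionality => x; apply: Derive_ext => h.
    by rewrite upd_at.
  right; apply: functional_extensionality => x.
  have -> : 0 = Derive (fun _ => g (x i)) (x j) by rewrite Derive_const.
  by apply: Derive_ext => h; rewrite /upd; case: eqP => // e; case: ji.
- move=> x; exact: continuous_const.
- move=> x j; exact: ex_derive_const.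
- move=> j; right; apply: functional_extensionality => x; exact: Derive_const.
Qed.

Lemma curve_smooth (X : frolicher) (c : R -> X) : curve c -> smooth (c : line -> X).
Proof.
move=> hc r hr; apply/curveP => h hh.
have sr : smoothR r by have := hr id erefl.
have sh : smoothR (fun t => h (c t)) by move/curveP: hc; apply.
(* Composition of smooth functions of one variable is the case of a single coordinate, indexed by
   [tt]. *)
exact: (Cinf_smoothR (c := fun t _ => r t) (smoothR_Cinf tt sh)).
Qed.

Lemma smooth_section (Z Y X : frolicher) (F : Z -> Y -> X) z :
  smooth (fun p : product Z Y => F p.1 p.2) -> smooth (F z).
Proof.
move=> sF; apply: (smooth_comp (f := fun y => (z, y) : product Z Y) sF).
by apply: smooth_pair => //; apply: const_smooth.
Qed.

Lemma hom_eq (X Y : frolicher) (f g : hom X Y) : (forall x, f x = g x) -> f = g.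
Proof.
case: f g => [f sf] [g sg] /= e; have efg : f = g by apply: functional_extensionality.
by subst g; rewrite (proof_irrelevance _ sf sg).
Qed.

Definition hom_comp (X Y Z : frolicher) (g : hom Y Z) (f : hom X Y) : hom X Z :=
  Hom (smooth_comp (@hom_smooth _ _ g) (@hom_smooth _ _ f)).

Lemma smoothR_id : smoothR id.
Proof.
move=> [|[|n]] x //=; first exact: ex_derive_id.
have [a ha] : exists a, Derive (Derive_n id n) = fun _ => a.
  elim: n => [|n [a /= ->]] /=.
    by exists 1; apply: functional_extensionality => y; apply: Derive_id.
  by exists 0; apply: functional_extensionality => y; apply: Derive_const.
by rewrite ha; apply: ex_derive_const.
Qed.

Lemma curve_id : @curve line id.
Proof. by move=> _ ->; apply: smoothR_id. Qed.

Lemma smooth_curve (X : frolicher) (c : line -> X) : smooth c -> curve c.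
Proof. by apply; apply: curve_id. Qed.

Lemma smooth_eval (X Y : frolicher) (y : Y) : smooth (fun g : expo Y X => g y).
Proof.
apply: smooth_gen_curves => c sc; apply: smooth_curve.
apply: (smooth_comp (f := fun t : line => (t, y) : product line Y) sc).
by apply: smooth_pair => //; apply: const_smooth.
Qed.

Lemma smooth_postcomp (X Y Z : frolicher) (g : hom Y Z) :
  smooth (hom_comp g : expo X Y -> expo X Z).
Proof.
apply: smooth_gen_curves => c sc; apply: curve_gen.
exact: smooth_comp (@hom_smooth _ _ g) sc.
Qed.

Lemma smooth_precomp (X Y Z : frolicher) (f : hom X Y) :
  smooth ((fun g => hom_comp g f) : expo Y Z -> expo X Z).
Proof.
apply: smooth_gen_curves => c sc; apply: curve_gen.
apply: (smooth_comp (f := fun z : product line X => (z.1, f z.2) : product line Y) sc).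
apply: smooth_pair; first exact: smooth_fst.
exact: smooth_comp (@hom_smooth _ _ f) (@smooth_snd _ _).
Qed.

(** * Jets and the functoriality of prolongation *)

Section Jets.
Variables (X : frolicher) (W : presentation).
Implicit Types f g : hom (Rn (idx W)) X.

Lemma germ_refl f : germ_equiv f f.
Proof.
split=> // h _; have [h0 _ _] := ideal_closed W.
rewrite (_ : (fun x => _) = fun _ => 0) //.
by apply: functional_extensionality => x; apply: Rminus_diag_eq.
Qed.

Lemma germ_sym f g : germ_equiv f g -> germ_equiv g f.
Proof.
move=> [e hfg]; split=> // h hh; have [_ _ hM] := ideal_closed W.
have := hM _ _ (Cinf_const (-1)) (hfg h hh); congr (ideal W _).
by apply: functional_extensionality => x; ring.
Qed.

Lemma germ_trans f g k : germ_equiv f g -> germ_equiv g k -> germ_equiv f k.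
Proof.
move=> [e hfg] [e' hgk]; split=> [|h hh]; first by rewrite e.
have [_ hD _] := ideal_closed W.
have := hD _ _ (hfg h hh) (hgk h hh); congr (ideal W _).
by apply: functional_extensionality => x; ring.
Qed.

Lemma cl_eqP f g : germ_equiv f g <-> cl f = cl g.
Proof.
split=> [h|[e]]; last by rewrite e; apply: germ_refl.
have e : germ_equiv f = germ_equiv g.
  apply: functional_extensionality => k; apply: propositional_extensionality.
  split; apply: germ_trans => //; exact: germ_sym.
rewrite /cl; move: (ex_intro _ f _) (ex_intro _ g _); rewrite e => p q.
by rewrite (proof_irrelevance _ p q).
Qed.

Lemma cl_rep (xi : X ⊗ W) : cl (rep xi) = xi.
Proof.
rewrite /rep; case: constructive_indefinite_description => f /=.
case: xi => A hA /= e; subst A; rewrite /cl.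
by move: (ex_intro _ f _) hA => p q; rewrite (proof_irrelevance _ p q).
Qed.

Lemma jet_cl (f : Rn (idx W) -> X) (sf : smooth f) : jet W f = cl (Hom sf).
Proof.
rewrite /jet; case: excluded_middle_informative => // s.
by rewrite (proof_irrelevance _ s sf).
Qed.

(** Lets later computations replace a point by the jet of a smooth map, for which the default branch
    of [jet] is excluded. *)
Lemma jetP (xi : X ⊗ W) : exists2 f : Rn (idx W) -> X, smooth f & xi = jet W f.
Proof.
exists (rep xi); first exact: hom_smooth.
rewrite (jet_cl (@hom_smooth _ _ (rep xi))) -{1}(cl_rep xi).
by congr (cl _); apply: hom_eq.
Qed.

Lemma jet_eq (f g : Rn (idx W) -> X) : (forall x, f x = g x) -> jet W f = jet W g.
Proof. by move=> e; congr (jet W _); apply: functional_extensionality. Qed.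

Lemma rep_jet (f : Rn (idx W) -> X) (sf : smooth f) : germ_equiv (rep (jet W f)) (Hom sf).
Proof. by apply/cl_eqP; rewrite cl_rep (jet_cl sf). Qed.

(** Along a curve of [Z] the maps [F z] themselves form a curve of representatives, as the
    generating curves of a prolongation require. *)
Lemma jet_smooth (Z : frolicher) (F : Z -> Rn (idx W) -> X) :
  smooth (fun p : product Z (Rn (idx W)) => F p.1 p.2) -> smooth (fun z => jet W (F z)).
Proof.
move=> sF c hc; apply: curve_gen.
exists (fun t => Hom (smooth_section (c t) sF)).
  apply: curve_gen => /=.
  apply: (smooth_comp (f := fun z : product line (Rn (idx W)) => (c z.1, z.2) : product Z _) sF).
  apply: smooth_pair; last exact: smooth_snd.
  exact: smooth_comp (curve_smooth hc) (@smooth_fst _ _).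
by apply: functional_extensionality => t; rewrite (jet_cl (smooth_section (c t) sF)).
Qed.

Lemma proj_smooth : smooth (@proj X W).
Proof.
apply: smooth_gen_curves => _ [c hc ->].
have := smooth_eval (X := X) (origin : Rn (idx W)) hc.
congr (curve _); apply: functional_extensionality => t; exact/esym/proj_cl.
Qed.

End Jets.

Section Functoriality.
Variables (X Y : frolicher) (W : presentation) (u : X -> Y).
Hypothesis su : smooth u.

Lemma tmap_jet (f : Rn (idx W) -> X) : smooth f -> tmap u (jet W f) = jet W (fun x => u (f x)).
Proof.
move=> sf; rewrite /tmap; have [e h] := rep_jet sf.
rewrite (jet_cl (smooth_comp su (@hom_smooth _ _ (rep (jet W f))))) (jet_cl (smooth_comp su sf)).
apply/cl_eqP; split=> [|k hk] /=; first by rewrite e.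
exact: h (fun x => k (u x)) (scalar_comp hk su).
Qed.

Lemma tmap_smooth : smooth (tmap u : X ⊗ W -> Y ⊗ W).
Proof.
apply: smooth_gen_curves => _ [c hc ->]; apply: curve_gen.
exists (fun t => hom_comp (Hom su) (c t)).
  exact: (smooth_postcomp (X := Rn (idx W)) (Hom su) hc).
apply: functional_extensionality => t.
have -> : cl (c t) = jet W (c t).
  by rewrite (jet_cl (@hom_smooth _ _ (c t))); congr (cl _); apply: hom_eq.
rewrite tmap_jet; last exact: hom_smooth.
rewrite (jet_cl (smooth_comp su (@hom_smooth _ _ (c t)))).
by congr (cl _); apply: hom_eq.
Qed.

Lemma proj_tmap (xi : X ⊗ W) : proj (tmap u xi) = u (proj xi).
Proof. by rewrite /tmap proj_jet. Qed.

End Functoriality.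

Lemma tmap_comp (X Y Z : frolicher) (W : presentation) (v : Y -> Z) (u : X -> Y) (xi : X ⊗ W) :
  smooth v -> smooth u -> tmap v (tmap u xi) = tmap (fun x => v (u x)) xi.
Proof.
move=> sv su; case: (jetP xi) => f sf ->.
by rewrite !tmap_jet //; [exact: smooth_comp|exact: smooth_comp].
Qed.

Lemma tmap_ext (X Y : frolicher) (W : presentation) (u v : X -> Y) (xi : X ⊗ W) :
  (forall x, u x = v x) -> tmap u xi = tmap v xi.
Proof. by move=> e; rewrite (functional_extensionality _ _ e). Qed.

Lemma tmap_id (X : frolicher) (W : presentation) (xi : X ⊗ W) : tmap (fun x => x) xi = xi.
Proof. by case: (jetP xi) => f sf ->; rewrite tmap_jet. Qed.

Lemma tmap_inj (X Y : frolicher) (W : presentation) (u : X -> Y) :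
  diffeo u -> injective (tmap u : X ⊗ W -> Y ⊗ W).
Proof.
move=> [su [v [sv uK _]]]; apply: (can_inj (g := tmap v)) => xi.
by rewrite tmap_comp // (tmap_ext _ uK) tmap_id.
Qed.

Lemma jet_pull (X : frolicher) (W W' : presentation) (th : (idx W' -> R) -> idx W -> R)
    (f : Rn (idx W) -> X) :
  weil_hom th -> smooth f -> pull W W' th (jet W f) = jet W' (fun x => f (th x)).
Proof.
move=> [sth th0 hth] sf; rewrite /pull; have [e h] := rep_jet sf.
rewrite (jet_cl (smooth_comp (@hom_smooth _ _ (rep (jet W f))) sth)) (jet_cl (smooth_comp sf sth)).
apply/cl_eqP; split=> [|k hk] /=; first by rewrite th0 e.
exact: hth _ (h k hk).
Qed.

Lemma pull_smooth (X : frolicher) (W W' : presentation) (th : (idx W' -> R) -> idx W -> R) :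
  weil_hom th -> smooth (pull W W' th : X ⊗ W -> X ⊗ W').
Proof.
move=> hth; case: (hth) => sth th0 _.
apply: smooth_gen_curves => _ [c hc ->]; apply: curve_gen.
exists (fun t => hom_comp (c t) (Hom sth)).
  exact: (smooth_precomp (Z := X) (Hom sth) hc).
apply: functional_extensionality => t.
have -> : cl (c t) = jet W (c t).
  by rewrite (jet_cl (@hom_smooth _ _ (c t))); congr (cl _); apply: hom_eq.
rewrite jet_pull //; last exact: hom_smooth.
rewrite (jet_cl (smooth_comp (@hom_smooth _ _ (c t)) sth)).
by congr (cl _); apply: hom_eq.
Qed.

Lemma weil_hom_comp (W W' W'' : presentation)
    (th : (idx W' -> R) -> idx W -> R) (th' : (idx W'' -> R) -> idx W' -> R) :
  weil_hom th -> weil_hom th' -> @weil_hom W W'' (fun x => th (th' x)).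
Proof.
move=> [sth th0 ith] [sth' th0' ith']; split; last by move=> g /ith /ith'.
  exact: (@smooth_comp (Rn _) (Rn _) (Rn _) th th' sth sth').
by rewrite th0'.
Qed.

Lemma pull_comp (X : frolicher) (W W' W'' : presentation)
    (th : (idx W' -> R) -> idx W -> R) (th' : (idx W'' -> R) -> idx W' -> R) (xi : X ⊗ W) :
  weil_hom th -> weil_hom th' ->
  pull W' W'' th' (pull W W' th xi) = pull W W'' (fun x => th (th' x)) xi.
Proof.
move=> hth hth'; case: (jetP xi) => f sf ->; case: (hth) => sth _ _.
rewrite (jet_pull hth sf) (jet_pull (weil_hom_comp hth hth') sf) (jet_pull hth') //.
exact: smooth_comp sf sth.
Qed.

Lemma pull_ext (X : frolicher) (W W' : presentation)
    (th th' : (idx W' -> R) -> idx W -> R) (xi : X ⊗ W) :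
  (forall x i, th x i = th' x i) -> pull W W' th xi = pull W W' th' xi.
Proof.
move=> e; congr (pull W W' _ xi); apply: functional_extensionality => x.
exact: functional_extensionality.
Qed.

Lemma pull_tmap (X Y : frolicher) (W W' : presentation) (u : X -> Y)
    (th : (idx W' -> R) -> idx W -> R) (xi : X ⊗ W) :
  smooth u -> weil_hom th -> pull W W' th (tmap u xi) = tmap u (pull W W' th xi).
Proof.
move=> su hth; case: (jetP xi) => f sf ->; case: (hth) => sth _ _.
rewrite tmap_jet // (jet_pull hth (smooth_comp su sf)) (jet_pull hth sf).
by rewrite tmap_jet //; exact: smooth_comp sf sth.
Qed.

(** * The exponential law (X ⊗ W1) ⊗ W2 = X ⊗ (W1 ⊗ W2) *)

Section Curry.
Variables (X : frolicher) (W1 W2 : presentation).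
Hypothesis X_exp : weil_exponentiable X.
Hypothesis W1_weil : weil W1.
Hypothesis W2_weil : weil W2.

(* Exponentiability is used for the one-point space Y only. As the formula for Th u y holds
   for all representatives, it shows that [curry] does not depend on the representative. *)
Let pt := Rn void.
Let pt0 : pt := origin.
Let cst (Z : frolicher) (z : Z) : expo pt Z := Hom (@const_smooth pt Z z).

Let cst_smooth Z : smooth (@cst Z).
Proof.
move=> c hc; apply: curve_gen => /=.
exact: smooth_comp (curve_smooth hc) (@smooth_fst _ _).
Qed.

Let cst_eval Z (g : expo pt Z) : cst (g pt0) = g.
Proof.
by apply: hom_eq => x /=; congr (hom_fun g); apply: functional_extensionality => -[].
Qed.

Let curry_char : exists2 Th : (expo pt (X ⊗ W1)) ⊗ W2 -> expo pt (X ⊗ wtensor W1 W2),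
    diffeo Th &
    forall u (f : Rn (idx (wtensor W1 W2)) -> X), smooth f ->
      Th u pt0 = jet (wtensor W1 W2) f ->
      tmap (fun g : expo pt (X ⊗ W1) => g pt0) u
      = jet W2 (fun b => jet W1 (fun a => f (glue a b))).
Proof.
have [Th dTh hTh] := X_exp pt W1_weil W2_weil; exists Th => // u f sf e.
by rewrite (hTh u pt0 (Hom sf)) // e (jet_cl sf).
Qed.

Lemma curry_jet (f : Rn (idx (wtensor W1 W2)) -> X) : smooth f ->
  curry (jet (wtensor W1 W2) f) = jet W2 (fun b => jet W1 (fun a => f (glue a b))).
Proof.
move=> sf; have [Th [sTh [g [sg gK hg]]] hTh] := curry_char.
(* One preimage under [Th] is evaluated with two representatives of its value, [f] here and the one
   selected by [rep] next. *)
rewrite /curry -(hTh (g (cst (jet (wtensor W1 W2) f))) f sf); last by rewrite hg.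
apply/esym/hTh; first exact: hom_smooth.
rewrite hg /= (jet_cl (@hom_smooth _ _ (rep (jet (wtensor W1 W2) f)))).
rewrite -{1}[jet _ f]cl_rep; by congr (cl _); apply: hom_eq.
Qed.

(** [curry] is the composite of [cst], the inverse of [Th] and the prolonged evaluation at [pt0];
    the outer two are invertible because [pt] has a single point. *)
Lemma curry_diffeo : diffeo (@curry X W1 W2).
Proof.
have [Th [sTh [g [sg gK hg]]] hTh] := curry_char.
have sev : smooth (fun g : expo pt (X ⊗ W1) => g pt0) by apply: smooth_eval.
have e xi : curry xi = tmap (fun g : expo pt (X ⊗ W1) => g pt0) (g (cst xi)).
  case: (jetP xi) => f sf ->; rewrite curry_jet //; apply/esym/hTh => //.
  by rewrite hg.
have -> : @curry X W1 W2 = fun xi => tmap (fun g : expo pt (X ⊗ W1) => g pt0) (g (cst xi)).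
  exact: functional_extensionality.
split.
  exact: smooth_comp (tmap_smooth sev) (smooth_comp sg (@cst_smooth _)).
exists (fun v => Th (tmap (@cst _) v) pt0); split.
- exact: smooth_comp (@smooth_eval _ _ pt0) (smooth_comp sTh (tmap_smooth (@cst_smooth _))).
- move=> xi /=; rewrite (tmap_comp _ (@cst_smooth _) sev).
  by rewrite (tmap_ext _ (@cst_eval _)) tmap_id hg.
- move=> v /=; rewrite cst_eval gK (tmap_comp _ sev (@cst_smooth _)).
  exact: tmap_id.
Qed.

End Curry.

(** * Homomorphisms of the algebras of D^n *)

Lemma ideal_mul (W : presentation) a f :
  Cinf a -> ideal W f -> ideal W (fun x => a x * f x).
Proof. by case: (ideal_closed W) => _ _; apply. Qed.

Lemma ideal0 (W : presentation) : ideal W (fun _ => 0).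
Proof. by case: (ideal_closed W). Qed.

(** The smooth functions that substitution sends into the ideal of [W'] form a closed ideal, so it
    is enough that they include the generators. *)
Lemma gen_weil_hom (K : finType) (G : ((K -> R) -> R) -> Prop) (W' : presentation)
    (th : (idx W' -> R) -> K -> R) :
  (forall k, G k -> Cinf k) -> Cinf_map th -> th origin = origin ->
  (forall k, G k -> ideal W' (fun x => k (th x))) ->
  @weil_hom (gen_presentation G) W' th.
Proof.
move=> hG hth th0 hI; split=> [||f hf] //; first exact: smooth_Cinf_map.
have [I0 ID IM] := ideal_closed W'.
suff [] : Cinf f /\ ideal W' (fun x => f (th x)) by [].
apply: (hf (fun f => Cinf f /\ ideal W' (fun x => f (th x)))) => [|k []//|k Gk]; last first.
  by split; [exact: hG|exact: hI].
have [C0 CD CM] := closed_Cinf K.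
split=> [//|k l [hk ik] [hl il]|a k ha [hk ik]]; split; [exact: CD|exact: ID|exact: CM|].
by apply: (IM (fun x => a (th x))) => //; apply: Cinf_comp.
Qed.

Lemma Dn_ideal_sq n i : ideal (Dn n) (fun x => x i ^ 2).
Proof. by apply: gen_ideal_sub; exists i. Qed.

Lemma Dn_ideal_Cinf n f : ideal (Dn n) f -> Cinf f.
Proof. by case: (weil_Dn n) => h _ /h []. Qed.

Lemma Dn_weil_hom n (W' : presentation) (th : (idx W' -> R) -> 'I_n -> R) :
  Cinf_map th -> th origin = origin -> (forall i, ideal W' (fun x => th x i ^ 2)) ->
  @weil_hom (Dn n) W' th.
Proof.
move=> hth th0 hi; apply: gen_weil_hom => // k [i ->] //.
exact/Cinf_pow/Cinf_coord.
Qed.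

Lemma wtensor_ideal_l (W1 W2 : presentation) g :
  ideal W1 g -> ideal (wtensor W1 W2) (fun z => g (fun i => z (inl i))).
Proof. by move=> hg; apply: gen_ideal_sub; left; exists g. Qed.

Lemma wtensor_ideal_r (W1 W2 : presentation) g :
  ideal W2 g -> ideal (wtensor W1 W2) (fun z => g (fun i => z (inr i))).
Proof. by move=> hg; apply: gen_ideal_sub; right; exists g. Qed.

Lemma wtensor_weil_hom (W1 W2 W' : presentation) (th : (idx W' -> R) -> idx W1 + idx W2 -> R) :
  (forall g, ideal W1 g -> Cinf g) -> (forall g, ideal W2 g -> Cinf g) ->
  Cinf_map th -> th origin = origin ->
  (forall g, ideal W1 g -> ideal W' (fun x => g (fun i => th x (inl i)))) ->
  (forall g, ideal W2 g -> ideal W' (fun x => g (fun i => th x (inr i)))) ->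
  @weil_hom (wtensor W1 W2) W' th.
Proof.
move=> c1 c2 hth th0 h1 h2; apply: gen_weil_hom => // k [] [g hg ->].
- by apply: (@Cinf_comp _ _ g (fun z i => z (inl i))); [exact: c1|move=> i; exact: Cinf_coord].
- by apply: (@Cinf_comp _ _ g (fun z i => z (inr i))); [exact: c2|move=> i; exact: Cinf_coord].
- exact: h1.
- exact: h2.
Qed.

Lemma snoc_lift n (z : 'I_n + 'I_1 -> R) j : snoc z (lift ord_max j) = z (inl j).
Proof. by rewrite /snoc liftK. Qed.

Lemma snoc_max n (z : 'I_n + 'I_1 -> R) : snoc z ord_max = z (inr ord0).
Proof. by rewrite /snoc unlift_none. Qed.

Lemma ord_snoc_ind n (P : 'I_n.+1 -> Prop) :
  (forall j, P (lift ord_max j)) -> P ord_max -> forall j, P j.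
Proof. by move=> hl hm j; case: (unliftP ord_max j) => [k|] ->. Qed.

Lemma Cinf_ext (K : finType) (f g : (K -> R) -> R) : (forall x, f x = g x) -> Cinf g -> Cinf f.
Proof. by move=> e; rewrite (functional_extensionality _ _ e). Qed.

Lemma ideal_ext (W : presentation) (f g : (idx W -> R) -> R) :
  (forall x, f x = g x) -> ideal W g -> ideal W f.
Proof. by move=> e; rewrite (functional_extensionality _ _ e). Qed.

Lemma snoc_origin n : @snoc n origin = origin.
Proof.
by apply: functional_extensionality; apply: ord_snoc_ind => [j|]; rewrite ?snoc_lift ?snoc_max.
Qed.

Lemma weil_hom_perm n (s : 'S_n) : @weil_hom (Dn n) (Dn n) (perm_map s).
Proof.
apply: Dn_weil_hom => // [j|i]; first exact: Cinf_coord.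
exact: (@Dn_ideal_sq n (s i)).
Qed.

Lemma weil_hom_scale n a (i : 'I_n) : @weil_hom (Dn n) (Dn n) (scale_map a i).
Proof.
apply: Dn_weil_hom => [j||j]; last (rewrite /scale_map; case: eqP => _).
- rewrite /scale_map; case: eqP => _; last exact: Cinf_coord.
  by apply: Cinf_mult; [exact: Cinf_const|exact: Cinf_coord].
- exact: scale_map0.
- apply: (@ideal_ext (Dn n) _ (fun x => a ^ 2 * x j ^ 2)) => [x|]; first by ring.
  by apply: ideal_mul; [exact: Cinf_const|exact: Dn_ideal_sq].
- exact: Dn_ideal_sq.
Qed.

Lemma weil_hom_delete n (i : 'I_n.+1) : @weil_hom (Dn n) (Dn n.+1) (delete_map i).
Proof.
apply: Dn_weil_hom => // [j|j]; first exact: Cinf_coord.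
exact: (@Dn_ideal_sq n.+1 (lift i j)).
Qed.

Lemma weil_hom_insert n (i : 'I_n.+1) : @weil_hom (Dn n.+1) (Dn n) (insert_map i).
Proof.
apply: Dn_weil_hom => [j||j]; last (rewrite /insert_map; case: unlift => [k|]).
- rewrite /insert_map; case: unlift => [k|]; [exact: Cinf_coord|exact: Cinf_const].
- exact: insert_map0.
- exact: Dn_ideal_sq.
- by apply: (@ideal_ext (Dn n) _ (fun _ => 0)) => [x|]; [ring|exact: ideal0].
Qed.

Lemma weil_hom_kappa n : @weil_hom (Dn n.+1) (Dn n.+2) (@kappa_map n).
Proof.
apply: Dn_weil_hom => [j||j]; last (rewrite /kappa_map; case: eqP => _).
- rewrite /kappa_map; case: eqP => _; last exact: Cinf_coord.
  by apply: Cinf_mult; exact: Cinf_coord.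
- exact: kappa_map0.
- apply: (@ideal_ext (Dn n.+2) _ (fun x => x ord_max ^ 2 * x (lift ord_max j) ^ 2)) => [x|].
    by rewrite Rpow_mult_distr Rmult_comm.
  apply: ideal_mul; last exact: (@Dn_ideal_sq n.+2 (lift ord_max j)).
  exact: (Cinf_pow 2 (@Cinf_coord 'I_n.+2 ord_max)).
- exact: Dn_ideal_sq.
Qed.

Lemma weil_hom_mu n m (i : 'I_n) : @weil_hom (Dn n) (wtensor (Dn n) (Dm m)) (mu_map i).
Proof.
apply: Dn_weil_hom => [j||j]; last (rewrite /mu_map; case: eqP => _).
- rewrite /mu_map; case: eqP => _; last exact: (@Cinf_coord _ (inl j)).
  by apply: Cinf_mult; [exact: (@Cinf_coord _ (inr ord0))|exact: (@Cinf_coord _ (inl j))].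
- apply: functional_extensionality => j; rewrite /mu_map /origin; case: eqP => // _.
  exact: Rmult_0_r.
- apply: (@ideal_ext (wtensor (Dn n) (Dm m)) _ (fun z => z (inr ord0) ^ 2 * z (inl j) ^ 2)) => [z|].
    by rewrite Rpow_mult_distr.
  apply: ideal_mul; last exact: (@wtensor_ideal_l (Dn n) _ (fun x => x j ^ 2) (@Dn_ideal_sq n j)).
  exact: (Cinf_pow 2 (@Cinf_coord ('I_n + 'I_1)%type (inr ord0))).
- exact: (@wtensor_ideal_l (Dn n) _ (fun x => x j ^ 2) (@Dn_ideal_sq n j)).
Qed.

Lemma Cinf_map_snoc n : Cinf_map (@snoc n).
Proof.
apply: ord_snoc_ind => [j|].
- by apply: Cinf_ext (Cinf_coord (inl j)) => x; rewrite snoc_lift.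
- by apply: Cinf_ext (Cinf_coord (inr ord0)) => x; rewrite snoc_max.
Qed.

Lemma weil_hom_snoc n : @weil_hom (Dn n.+1) (wtensor (Dn n) (Dn 1)) (@snoc n).
Proof.
apply: Dn_weil_hom; [exact: Cinf_map_snoc|exact: snoc_origin|apply: ord_snoc_ind => [j|]].
- apply: (@ideal_ext (wtensor (Dn n) (Dn 1)) _ (fun z => z (inl j) ^ 2)) => [z|].
    by rewrite snoc_lift.
  exact: (@wtensor_ideal_l (Dn n) _ (fun x => x j ^ 2) (@Dn_ideal_sq n j)).
- apply: (@ideal_ext (wtensor (Dn n) (Dn 1)) _ (fun z => z (inr ord0) ^ 2)) => [z|].
    by rewrite snoc_max.
  exact: (@wtensor_ideal_r _ (Dn 1) (fun x => x ord0 ^ 2) (@Dn_ideal_sq 1 ord0)).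
Qed.

Definition unsnoc n (x : 'I_n.+1 -> R) : 'I_n + 'I_1 -> R :=
  glue (delete_map ord_max x) (fun _ => x ord_max).

Lemma weil_hom_unsnoc n : @weil_hom (wtensor (Dn n) (Dn 1)) (Dn n.+1) (@unsnoc n).
Proof.
apply: wtensor_weil_hom.
- exact: Dn_ideal_Cinf.
- exact: Dn_ideal_Cinf.
- by case=> j; apply: Cinf_coord.
- by apply: functional_extensionality => -[].
- by case: (@weil_hom_delete n ord_max).
- suff : @weil_hom (Dn 1) (Dn n.+1) (fun x _ => x ord_max) by case.
  apply: Dn_weil_hom => [j||j] //; first exact: Cinf_coord.
  exact: Dn_ideal_sq.
Qed.

Lemma snocK n : cancel (@unsnoc n) (@snoc n).
Proof.
move=> x; apply: functional_extensionality; apply: ord_snoc_ind => [j|].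
  by rewrite snoc_lift.
by rewrite snoc_max.
Qed.

Lemma unsnocK n : cancel (@snoc n) (@unsnoc n).
Proof.
move=> z; apply: functional_extensionality => -[j|j] /=; first by rewrite /delete_map snoc_lift.
by rewrite snoc_max (ord1 j).
Qed.

Lemma smooth_glue (Z : frolicher) (I J : Type) (a : Z -> Rn I) (b : Z -> Rn J) :
  smooth a -> smooth b -> smooth (fun z => glue (a z) (b z) : Rn (I + J)).
Proof.
move=> sa sb; apply: smooth_Rn => -[i|j] /=; first exact: scalar_comp (scalar_coord i) sa.
exact: scalar_comp (scalar_coord j) sb.
Qed.

Lemma smooth_scale (Z : frolicher) n (i : 'I_n) (r : Z -> R) (a : Z -> Rn 'I_n) :
  scalar r -> smooth a -> smooth (fun z => scale_map (r z) i (a z) : Rn 'I_n).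
Proof.
move=> sr sa; apply: smooth_Rn => j; rewrite /scale_map; case: eqP => _; last first.
  exact: scalar_comp (scalar_coord j) sa.
by apply: scalar_mult => //; exact: scalar_comp (scalar_coord j) sa.
Qed.

(** Common form of [curryD], where T is [snoc], and of [curry2], where T is [snoc2]: naturality is
    proved once for splitting off one or two coordinates. *)
Definition regroup (X : frolicher) (k m N : nat) (T : ('I_k + 'I_m -> R) -> 'I_N -> R)
    (xi : X ⊗ Dn N) : (X ⊗ Dn k) ⊗ Dn m :=
  curry (pull (Dn N) (wtensor (Dn k) (Dn m)) T xi).

Section Regroup.
Variables (X : frolicher) (k m N : nat) (T : ('I_k + 'I_m -> R) -> 'I_N -> R).
Hypothesis X_exp : weil_exponentiable X.
Hypothesis hT : @weil_hom (Dn N) (wtensor (Dn k) (Dn m)) T.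

Lemma smooth_regroup_fun (Z : frolicher) (f : Rn 'I_N -> X) (a : Z -> Rn 'I_k) (b : Z -> Rn 'I_m) :
  smooth f -> smooth a -> smooth b -> smooth (fun z => f (T (glue (a z) (b z)))).
Proof.
move=> sf sa sb; case: hT => sT _ _.
exact: (smooth_comp sf (smooth_comp sT (smooth_glue sa sb))).
Qed.

Lemma smooth_regroup_in (f : Rn 'I_N -> X) (b : Rn 'I_m) :
  smooth f -> smooth (fun a : Rn 'I_k => f (T (glue a b))).
Proof. by move=> sf; apply: smooth_regroup_fun => //; apply: const_smooth. Qed.

Lemma smooth_regroup_out (f : Rn 'I_N -> X) :
  smooth f -> smooth (fun b : Rn 'I_m => jet (Dn k) (fun a => f (T (glue a b)))).
Proof.
move=> sf; apply: (@jet_smooth X (Dn k) (Rn 'I_m)).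
by apply: smooth_regroup_fun => //; [exact: smooth_snd|exact: smooth_fst].
Qed.

Lemma regroup_jet (f : Rn 'I_N -> X) : smooth f ->
  regroup T (jet (Dn N) f) = jet (Dn m) (fun b => jet (Dn k) (fun a => f (T (glue a b)))).
Proof.
move=> sf; rewrite /regroup (jet_pull hT sf).
rewrite (curry_jet X_exp (weil_Dn k) (weil_Dn m)) //.
by case: hT => sT _ _; exact: (smooth_comp sf sT).
Qed.

(** [Th] is assumed to act on the outer coordinates only, so it merely reparametrizes the family of
    inner jets. *)
Lemma regroup_pull_out (N' m' : nat) (T' : ('I_k + 'I_m' -> R) -> 'I_N' -> R)
    (Th : ('I_N -> R) -> 'I_N' -> R) (th : ('I_m -> R) -> 'I_m' -> R) (xi : X ⊗ Dn N') :
  @weil_hom (Dn N') (wtensor (Dn k) (Dn m')) T' ->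
  @weil_hom (Dn N') (Dn N) Th -> @weil_hom (Dn m') (Dn m) th ->
  (forall a b j, Th (T (glue a b)) j = T' (glue a (th b)) j) ->
  regroup T (pull (Dn N') (Dn N) Th xi) = pull (Dn m') (Dn m) th (regroup T' xi).
Proof.
move=> hT' hTh hth e; case: (jetP xi) => f sf ->; have [sT' _ _] := hT'.
have [sTh _ _] := hTh.
rewrite (jet_pull hTh sf) (regroup_jet (smooth_comp sf sTh)).
rewrite /regroup (jet_pull hT' sf) (curry_jet X_exp (weil_Dn k) (weil_Dn m')); last first.
  exact: (smooth_comp sf sT').
rewrite (jet_pull hth).
  apply: jet_eq => b; apply: jet_eq => a; congr f; apply: functional_extensionality => j.
  exact: e.
apply: (@jet_smooth X (Dn k) (Rn 'I_m')); apply: (smooth_comp sf); apply: (smooth_comp sT').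
by apply: smooth_glue; [exact: smooth_snd|exact: smooth_fst].
Qed.

(** Here [Th] acts on the inner coordinates only, that is, inside each inner jet; hence the
    [tmap]. *)
Lemma regroup_pull_in (N' k' : nat) (T' : ('I_k' + 'I_m -> R) -> 'I_N' -> R)
    (Th : ('I_N -> R) -> 'I_N' -> R) (th : ('I_k -> R) -> 'I_k' -> R) (xi : X ⊗ Dn N') :
  @weil_hom (Dn N') (wtensor (Dn k') (Dn m)) T' ->
  @weil_hom (Dn N') (Dn N) Th -> @weil_hom (Dn k') (Dn k) th ->
  (forall a b j, Th (T (glue a b)) j = T' (glue (th a) b) j) ->
  regroup T (pull (Dn N') (Dn N) Th xi) = tmap (pull (Dn k') (Dn k) th) (regroup T' xi).
Proof.
move=> hT' hTh hth e; case: (jetP xi) => f sf ->; have [sT' _ _] := hT'.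
have [sTh _ _] := hTh.
rewrite (jet_pull hTh sf) (regroup_jet (smooth_comp sf sTh)).
rewrite /regroup (jet_pull hT' sf) (curry_jet X_exp (weil_Dn k') (weil_Dn m)); last first.
  exact: (smooth_comp sf sT').
rewrite (tmap_jet (pull_smooth hth)); last first.
  apply: (@jet_smooth X (Dn k') (Rn 'I_m)); apply: (smooth_comp sf); apply: (smooth_comp sT').
  by apply: smooth_glue; [exact: smooth_snd|exact: smooth_fst].
apply: jet_eq => b; rewrite (jet_pull hth).
  apply: jet_eq => a; congr f; apply: functional_extensionality => j; exact: e.
apply: (smooth_comp sf); apply: (smooth_comp sT').
by apply: smooth_glue => //; exact: const_smooth.
Qed.

(** Projecting the inner jets freezes the inner coordinates at 0; in [proj_regroup] the outer ones
    are frozen. *)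
Lemma tmap_proj_regroup (th : ('I_m -> R) -> 'I_N -> R) (xi : X ⊗ Dn N) :
  @weil_hom (Dn N) (Dn m) th -> (forall b j, th b j = T (glue origin b) j) ->
  tmap (@proj X (Dn k)) (regroup T xi) = pull (Dn N) (Dn m) th xi.
Proof.
move=> hth e; case: (jetP xi) => f sf ->.
rewrite regroup_jet // (tmap_jet (W := Dn m) (@proj_smooth X (Dn k)) (smooth_regroup_out sf)).
rewrite jet_pull //; apply: jet_eq => b; rewrite proj_jet; congr f.
by apply: functional_extensionality => j; rewrite e.
Qed.

Lemma proj_regroup (th : ('I_k -> R) -> 'I_N -> R) (xi : X ⊗ Dn N) :
  @weil_hom (Dn N) (Dn k) th -> (forall a j, th a j = T (glue a origin) j) ->
  proj (regroup T xi) = pull (Dn N) (Dn k) th xi.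
Proof.
move=> hth e; case: (jetP xi) => f sf ->.
rewrite regroup_jet // proj_jet jet_pull //; apply: jet_eq => b; congr f.
by apply: functional_extensionality => j; rewrite e.
Qed.

End Regroup.

Lemma regroup_tmap (X Y : frolicher) (k m N : nat) (T : ('I_k + 'I_m -> R) -> 'I_N -> R)
    (u : X -> Y) (xi : X ⊗ Dn N) :
  weil_exponentiable X -> weil_exponentiable Y ->
  @weil_hom (Dn N) (wtensor (Dn k) (Dn m)) T -> smooth u ->
  regroup T (tmap u xi) = tmap (tmap u) (regroup T xi).
Proof.
move=> X_exp Y_exp hT su; case: (jetP xi) => f sf ->.
rewrite (tmap_jet su sf) (regroup_jet Y_exp hT (smooth_comp su sf)).
rewrite (regroup_jet X_exp hT sf).
rewrite (tmap_jet (W := Dn m) (tmap_smooth su) (smooth_regroup_out hT sf)).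
by apply: jet_eq => b; rewrite (tmap_jet (W := Dn k) su (smooth_regroup_in hT b sf)).
Qed.

Lemma curryD_regroup (X : frolicher) n : @curryD X n = regroup (@snoc n).
Proof. by []. Qed.

Section CurryD.
Variables (X : frolicher).
Hypothesis X_exp : weil_exponentiable X.

Lemma curryD_diffeo n : @diffeo (X ⊗ Dn n.+1) ((X ⊗ Dn n) ⊗ Dn 1) (@curryD X n).
Proof.
have [sc [g [sg cK gK]]] := curry_diffeo X_exp (weil_Dn n) (weil_Dn 1).
split; first by have sp := pull_smooth (X := X) (@weil_hom_snoc n); exact: (smooth_comp sc sp).
exists (fun xi => pull (wtensor (Dn n) (Dn 1)) (Dn n.+1) (@unsnoc n) (g xi)); split.
- have sp := pull_smooth (X := X) (@weil_hom_unsnoc n); exact: (smooth_comp sp sg).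
- move=> xi; rewrite /curryD cK pull_comp; [|exact: weil_hom_snoc|exact: weil_hom_unsnoc].
  case: (jetP xi) => f sf ->; rewrite jet_pull //.
    by apply: jet_eq => x; rewrite snocK.
  exact: weil_hom_comp (@weil_hom_snoc n) (@weil_hom_unsnoc n).
- move=> xi; rewrite /curryD pull_comp; [|exact: weil_hom_unsnoc|exact: weil_hom_snoc].
  rewrite -{2}(gK xi); congr (curry _); case: (jetP (g xi)) => f sf ->; rewrite jet_pull //.
    by apply: jet_eq => x; rewrite unsnocK.
  exact: weil_hom_comp (@weil_hom_unsnoc n) (@weil_hom_snoc n).
Qed.

Lemma curryD_inj n : injective (@curryD X n).
Proof. by case: (curryD_diffeo n) => _ [g [_ /can_inj]]. Qed.

Lemma curryD_jet n (f : Rn 'I_n.+1 -> X) : smooth f ->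
  curryD (jet (Dn n.+1) f) = jet (Dn 1) (fun b => jet (Dn n) (fun a => f (snoc (glue a b)))).
Proof. exact: (regroup_jet X_exp (@weil_hom_snoc n)). Qed.

(** The map d |-> (0, .., 0, d); pulling g back along it gives the tangent vector t to which nabla
    is applied. *)
Definition last_map n (b : 'I_1 -> R) : 'I_n.+1 -> R := snoc (glue origin b).

Lemma weil_hom_last n : @weil_hom (Dn n.+1) (Dn 1) (@last_map n).
Proof.
apply: Dn_weil_hom => [||].
- apply: ord_snoc_ind => [j|].
    by apply: Cinf_ext (Cinf_const 0) => x; rewrite /last_map snoc_lift.
  by apply: Cinf_ext (Cinf_coord ord0) => x; rewrite /last_map snoc_max.
- rewrite /last_map (_ : glue _ _ = origin) ?snoc_origin //.
  by apply: functional_extensionality => -[].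
- apply: ord_snoc_ind => [j|].
    apply: (@ideal_ext (Dn 1) _ (fun _ => 0)) => [x|]; last exact: ideal0.
    by rewrite /last_map snoc_lift /= Rmult_0_l.
  apply: (@ideal_ext (Dn 1) _ (fun x => x ord0 ^ 2)) => [x|]; last exact: Dn_ideal_sq.
  by rewrite /last_map snoc_max.
Qed.

Lemma tmap_proj_curryD n (xi : X ⊗ Dn n.+1) :
  tmap (@proj X (Dn n)) (curryD xi) = pull (Dn n.+1) (Dn 1) (@last_map n) xi.
Proof. exact: (tmap_proj_regroup X_exp (@weil_hom_snoc n) _ (@weil_hom_last n)). Qed.

Lemma insert_maxE n (a : 'I_n -> R) j : insert_map ord_max a j = snoc (glue a origin) j.
Proof. by rewrite /insert_map /snoc; case: unlift. Qed.

Lemma proj_curryD n (xi : X ⊗ Dn n.+1) :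
  proj (curryD xi) = pull (Dn n.+1) (Dn n) (insert_map ord_max) xi.
Proof.
exact: (proj_regroup X_exp (@weil_hom_snoc n) _ (@weil_hom_insert n ord_max) (@insert_maxE n)).
Qed.

Lemma curryD_delete n (xi : X ⊗ Dn n) :
  curryD (pull (Dn n) (Dn n.+1) (delete_map ord_max) xi) = const_jet (Dn 1) xi.
Proof.
case: (jetP xi) => f sf ->; have hd := @weil_hom_delete n ord_max.
case: (hd) => sd _ _; rewrite (jet_pull hd sf) (curryD_jet (smooth_comp sf sd)).
apply: jet_eq => b; apply: jet_eq => a; congr f; apply: functional_extensionality => j.
by rewrite /delete_map snoc_lift.
Qed.

Lemma curryD_kappa n (xi : X ⊗ Dn n.+1) :
  curryD (pull (Dn n.+1) (Dn n.+2) (@kappa_map n) xi)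
  = jet (Dn 1) (fun b => pull (Dn n.+1) (Dn n.+1) (scale_map (b ord0) ord_max) xi).
Proof.
case: (jetP xi) => f sf ->; have hk := @weil_hom_kappa n.
case: (hk) => sk _ _; rewrite (jet_pull hk sf) (curryD_jet (smooth_comp sf sk)).
apply: jet_eq => b; rewrite (jet_pull (weil_hom_scale (b ord0) ord_max) sf).
apply: jet_eq => a; congr f; apply: functional_extensionality => j.
rewrite /kappa_map /scale_map !snoc_lift !snoc_max /=.
by case: eqP => _ //; rewrite Rmult_comm.
Qed.

Lemma curry_mu n m (i : 'I_n) (xi : X ⊗ Dn n) :
  curry (pull (Dn n) (wtensor (Dn n) (Dm m)) (mu_map i) xi)
  = jet (Dm m) (fun b => pull (Dn n) (Dn n) (scale_map (b ord0) i) xi).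
Proof.
case: (jetP xi) => f sf ->; have hm := @weil_hom_mu n m i.
case: (hm) => sm _ _; rewrite (jet_pull hm sf).
rewrite (curry_jet X_exp (weil_Dn n) (weil_Dm m) (smooth_comp sf sm)).
apply: jet_eq => b; rewrite (jet_pull (weil_hom_scale (b ord0) i) sf).
by apply: jet_eq => a; congr f.
Qed.

Lemma smooth_pull_scale (W : presentation) (k0 : idx W) n (i : 'I_n) (xi : X ⊗ Dn n) :
  smooth (fun b : Rn (idx W) => pull (Dn n) (Dn n) (scale_map (b k0) i) xi).
Proof.
case: (jetP xi) => f sf ->.
have -> : (fun b : Rn (idx W) => pull (Dn n) (Dn n) (scale_map (b k0) i) (jet (Dn n) f)) =
          fun b => jet (Dn n) (fun a => f (scale_map (b k0) i a)).
  by apply: functional_extensionality => b; rewrite (jet_pull (weil_hom_scale _ _) sf).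
apply: (@jet_smooth X (Dn n) (Rn (idx W))); apply: (smooth_comp sf); apply: smooth_scale.
  exact: scalar_comp (scalar_coord k0) (@smooth_fst _ _).
exact: smooth_snd.
Qed.

End CurryD.

Definition snoc2 n (z : 'I_n + 'I_2 -> R) : 'I_n.+2 -> R :=
  snoc (glue (snoc (glue (fun i => z (inl i)) (fun _ => z (inr ord0)))) (fun _ => z (inr ord_max))).

Lemma snoc2_lift n (z : 'I_n + 'I_2 -> R) j : snoc2 z (lift ord_max (lift ord_max j)) = z (inl j).
Proof. by rewrite /snoc2 snoc_lift /= snoc_lift. Qed.

Lemma snoc2_pre n (z : 'I_n + 'I_2 -> R) : snoc2 z (lift ord_max ord_max) = z (inr ord0).
Proof. by rewrite /snoc2 snoc_lift /= snoc_max. Qed.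

Lemma snoc2_max n (z : 'I_n + 'I_2 -> R) : snoc2 z ord_max = z (inr ord_max).
Proof. by rewrite /snoc2 snoc_max. Qed.

Lemma weil_hom_snoc2 n : @weil_hom (Dn n.+2) (wtensor (Dn n) (Dn 2)) (@snoc2 n).
Proof.
apply: Dn_weil_hom.
- apply: ord_snoc_ind => [|]; first apply: ord_snoc_ind => [j|].
  + by apply: Cinf_ext (Cinf_coord (inl j)) => x; rewrite snoc2_lift.
  + by apply: Cinf_ext (Cinf_coord (inr ord0)) => x; rewrite snoc2_pre.
  + by apply: Cinf_ext (Cinf_coord (inr ord_max)) => x; rewrite snoc2_max.
- apply: functional_extensionality.
  apply: ord_snoc_ind => [|]; first apply: ord_snoc_ind => [j|].
  + by rewrite snoc2_lift.
  + by rewrite snoc2_pre.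
  + by rewrite snoc2_max.
- apply: ord_snoc_ind => [|]; first apply: ord_snoc_ind => [j|].
  + apply: (@ideal_ext (wtensor (Dn n) (Dn 2)) _ (fun z => z (inl j) ^ 2)) => [z|].
      by rewrite snoc2_lift.
    exact: (@wtensor_ideal_l (Dn n) _ (fun x => x j ^ 2) (@Dn_ideal_sq n j)).
  + apply: (@ideal_ext (wtensor (Dn n) (Dn 2)) _ (fun z => z (inr ord0) ^ 2)) => [z|].
      by rewrite snoc2_pre.
    exact: (@wtensor_ideal_r _ (Dn 2) (fun x => x ord0 ^ 2) (@Dn_ideal_sq 2 ord0)).
  + apply: (@ideal_ext (wtensor (Dn n) (Dn 2)) _ (fun z => z (inr ord_max) ^ 2)) => [z|].
      by rewrite snoc2_max.
    exact: (@wtensor_ideal_r _ (Dn 2) (fun x => x ord_max ^ 2) (@Dn_ideal_sq 2 ord_max)).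
Qed.

Definition curry2 (X : frolicher) n : X ⊗ Dn n.+2 -> (X ⊗ Dn n) ⊗ Dn 2 := regroup (@snoc2 n).

(** Associativity of the identifications: detaching two coordinates at once or one after the other
    agrees. Statements about [curry2] are reduced to [curryD] in this way. *)
Lemma curryD_curry2 (X : frolicher) n (xi : X ⊗ Dn n.+2) :
  weil_exponentiable X -> weil_exponentiable (X ⊗ Dn n) ->
  curryD (curry2 xi) = tmap (@curryD X n) (curryD xi).
Proof.
move=> X_exp XW_exp; case: (jetP xi) => f sf ->.
rewrite /curry2 (regroup_jet X_exp (@weil_hom_snoc2 n) sf).
rewrite (curryD_jet XW_exp (smooth_regroup_out (@weil_hom_snoc2 n) sf)).
have [sc _] := curryD_diffeo X_exp n.
rewrite (curryD_jet X_exp sf).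
rewrite (tmap_jet (W := Dn 1) sc (smooth_regroup_out (@weil_hom_snoc n.+1) sf)).
apply: jet_eq => b; rewrite (curryD_jet X_exp (smooth_regroup_in (@weil_hom_snoc n.+1) b sf)).
apply: jet_eq => b'; apply: jet_eq => a; congr f; apply: functional_extensionality.
apply: ord_snoc_ind => [|]; first apply: ord_snoc_ind => [j|].
- by rewrite snoc2_lift !snoc_lift /= snoc_lift.
- rewrite snoc2_pre snoc_lift /= snoc_max /=.
  by rewrite (_ : ord0 = lift ord_max ord0) ?snoc_lift //; apply: val_inj.
- by rewrite snoc2_max !snoc_max /= snoc_max.
Qed.

Lemma curry2_inj (X : frolicher) n :
  weil_exponentiable X -> weil_exponentiable (X ⊗ Dn n) -> injective (@curry2 X n).
Proof.
move=> X_exp XW_exp xi xi' e; apply: (curryD_inj X_exp).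
apply: (tmap_inj (curryD_diffeo X_exp n)).
by rewrite -(curryD_curry2 xi X_exp XW_exp) -(curryD_curry2 xi' X_exp XW_exp) e.
Qed.

Lemma curryD_tmap (X Y : frolicher) n (u : X -> Y) (xi : X ⊗ Dn n.+1) :
  weil_exponentiable X -> weil_exponentiable Y -> smooth u ->
  curryD (tmap u xi) = tmap (tmap u) (curryD xi).
Proof. by move=> X_exp Y_exp su; apply: regroup_tmap => //; apply: weil_hom_snoc. Qed.

(** * Prolonged fibre products *)

Section FibProd.
Variables (B M : frolicher) (rho : B -> M).

Lemma smooth_fibprod1 W : smooth (@fibprod1 B M rho W).
Proof. exact: (smooth_comp (@smooth_fst _ _) (@smooth_incl _ _)). Qed.

Lemma smooth_fibprod2 W : smooth (@fibprod2 B M rho W).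
Proof. exact: (smooth_comp (@smooth_snd _ _) (@smooth_incl _ _)). Qed.

Lemma fibprodP W (z : fibprod rho W) : proj (fibprod2 z) = rho (fibprod1 z).
Proof. exact: (proj2_sig z). Qed.

Lemma smooth_to_fibprod W (Z : frolicher) (f : Z -> fibprod rho W) :
  smooth (fun x => fibprod1 (f x)) -> smooth (fun x => fibprod2 (f x)) -> smooth f.
Proof.
move=> s1 s2; apply: smooth_sub; have := smooth_pair s1 s2.
congr (smooth _); apply: functional_extensionality => x.
by rewrite /fibprod1 /fibprod2; case: (incl (f x)).
Qed.

Hypothesis FP : fibprod_preserved rho.
Variables (W W' : presentation).
Hypotheses (hW : weil W) (hW' : weil W').

Lemma fibprod_lift (T : frolicher) (a : T -> B ⊗ W') (b : T -> (M ⊗ W) ⊗ W') :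
  smooth a -> smooth b -> (forall t, tmap rho (a t) = tmap (@proj M W) (b t)) ->
  exists u : T -> fibprod rho W ⊗ W',
    [/\ smooth u, forall t, tmap (@fibprod1 _ _ _ _) (u t) = a t &
        forall t, tmap (@fibprod2 _ _ _ _) (u t) = b t].
Proof.
move=> sa sb e; have [_ h] := FP hW hW'.
by have [u [hu _]] := h T a b sa sb e; exists u.
Qed.

Lemma fibprod_tmap_inj (u u' : fibprod rho W ⊗ W') :
  tmap (@fibprod1 _ _ _ _) u = tmap (@fibprod1 _ _ _ _) u' ->
  tmap (@fibprod2 _ _ _ _) u = tmap (@fibprod2 _ _ _ _) u' -> u = u'.
Proof.
move=> e1 e2; have [c h] := FP hW hW'.
(* Points are regarded as constant maps on the line, to which the uniqueness clause of the pullback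
   applies. *)
have [v [_ hv]] := h line
  (fun _ => tmap (@fibprod1 _ _ _ _) u) (fun _ => tmap (@fibprod2 _ _ _ _) u)
  (const_smooth _) (const_smooth _) (fun _ => c u).
have ev x : tmap (@fibprod1 _ _ _ _) x = tmap (@fibprod1 _ _ _ _) u ->
    tmap (@fibprod2 _ _ _ _) x = tmap (@fibprod2 _ _ _ _) u -> v = fun _ => x.
  by move=> h1 h2; apply: hv; split=> // c' _; apply: const_smooth => //; exact: curve_id.
by have := ev u erefl erefl; rewrite (ev u') // => /(congr1 (fun k => k 0)) /= ->.
Qed.

End FibProd.

Section FibprodMap.
Variables (B B' M : frolicher) (rho : B -> M) (rho' : B' -> M) (W W' : presentation).
Variables (f : B -> B') (g : M ⊗ W -> M ⊗ W').
Hypotheses (rho_f : forall b, rho' (f b) = rho b) (proj_g : forall x, proj (g x) = proj x).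

Definition fibprod_map (z : fibprod rho W) : fibprod rho' W' :=
  exist _ (f (fibprod1 z), g (fibprod2 z))
    (etrans (proj_g _) (etrans (fibprodP z) (esym (rho_f _)))).

Lemma smooth_fibprod_map : smooth f -> smooth g -> smooth fibprod_map.
Proof.
move=> sf sg; apply: smooth_to_fibprod.
- exact: (smooth_comp sf (@smooth_fibprod1 _ _ _ _)).
- exact: (smooth_comp sg (@smooth_fibprod2 _ _ _ _)).
Qed.

End FibprodMap.

Lemma tmap_const_jet (X Y : frolicher) (W : presentation) (u : X -> Y) x :
  smooth u -> tmap u (const_jet W x) = const_jet W (u x).
Proof. by move=> su; rewrite /const_jet tmap_jet //; apply: const_smooth. Qed.

Lemma pull_scale0 (X : frolicher) (i : 'I_1) (xi : X ⊗ Dn 1) :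
  pull (Dn 1) (Dn 1) (scale_map 0 i) xi = const_jet (Dn 1) (proj xi).
Proof.
case: (jetP xi) => f sf ->; rewrite (jet_pull (weil_hom_scale 0 i) sf) proj_jet.
apply: jet_eq => x; congr f; apply: functional_extensionality => j.
by rewrite /scale_map (ord1 i) (ord1 j) eqxx Rmult_0_l.
Qed.

(** The type of the argument depends on the base point of the map, so arguments are compared in M ⊗
    W_{D^n}. *)
Lemma fibmap_app_eq (n : nat) (B M : frolicher) (rho : B -> M) (a b : fibmap n rho) ga gb :
  a = b -> incl ga = incl gb -> a ga = b gb.
Proof. by move=> e; subst b => /incl_inj ->. Qed.

Lemma fibmap_eq (n : nat) (B M : frolicher) (rho : B -> M) (a b : fibmap n rho) :
  base a = base b -> (forall ga gb, incl ga = incl gb -> a ga = b gb) -> a = b.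
Proof.
case: a b => [x f] [y g] /= e; subst y => h; congr Fibmap.
by apply: functional_extensionality => ga; apply: h.
Qed.

(* (id ⊗ W_mu_i)(g) is the jet of e |-> e ._i g, so the condition on mu_i follows from
   homogeneity and smoothness. *)
Lemma mu_of_scale (n : nat) (B M : frolicher) (rho : B -> M) (nab : fibmap n rho) :
  weil_exponentiable B -> weil_exponentiable M -> smooth nab ->
  (forall a i g, nab (fpull (@scale_map0 n a i) g) = pull (Dn n) (Dn n) (scale_map a i) (nab g)) ->
  forall m i g, exists2 u : fib n (rho (base nab)) ⊗ Dm m,
    curry (pull (Dn n) (wtensor (Dn n) (Dm m)) (mu_map i) (incl g)) = tmap (@incl _ _) u &
    tmap nab u = curry (pull (Dn n) (wtensor (Dn n) (Dm m)) (mu_map i) (nab g)).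
Proof.
move=> B_exp M_exp snab hs m i g.
have sF : smooth (fun b : Rn 'I_1 => fpull (@scale_map0 n (b ord0) i) g).
  by apply: smooth_sub; exact: (@smooth_pull_scale M (Dm m) ord0).
exists (jet (Dm m) (fun b => fpull (@scale_map0 n (b ord0) i) g)).
- by rewrite (curry_mu M_exp) (tmap_jet (W := Dm m) (@smooth_incl _ _) sF).
- rewrite (curry_mu B_exp) (tmap_jet (W := Dm m) snab sF).
  by apply: jet_eq => b.
Qed.

(** * Passing from n to n + 1 *)

Lemma last_map0 n : @last_map n origin = origin.
Proof. by case: (@weil_hom_last n). Qed.

Section Step.
Variables (B E M : frolicher) (pi : E -> M) (rho : B -> M) (n : nat) (b0 : B -> E).
Variables (N : fibmap 1 rho) (Ev : fibprod rho (Dn n) -> E ⊗ Dn n).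
Hypotheses (pi_smooth : smooth pi) (rho_smooth : smooth rho) (Ev_smooth : smooth Ev).
Hypotheses (E_exp : weil_exponentiable E) (M_exp : weil_exponentiable M).
Hypothesis (FP : fibprod_preserved rho).
Hypothesis (N_pseudo : pseudotangential N).
Hypothesis (proj_Ev : forall z, proj (Ev z) = b0 (fibprod1 z)).
Hypothesis (tmap_Ev : forall z, tmap pi (Ev z) = fibprod2 z).
Variables (m : M) (hm : m = rho (base N)).

(** [m] and [rho (base N)] are kept apart because in the application they are [pi (J_base ..)] and
    [J_proj ..], which agree by a proof only. *)
Definition last_fib (g : fib n.+1 m) : fib 1 (rho (base N)) :=
  exist _ (pull (Dn n.+1) (Dn 1) (@last_map n) (incl g))
    (etrans (proj_pull (incl g) (@last_map0 n)) (etrans (proj2_sig g) hm)).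

Lemma smooth_last_fib : smooth last_fib.
Proof.
by apply: smooth_sub; exact: (smooth_comp (pull_smooth (@weil_hom_last n)) (@smooth_incl _ _)).
Qed.

(* [w] is the pair (N(t), g) of the definitions of Phi and phi_(n+1), seen as an element of
   (B x_M (M ⊗ W_{D^n})) ⊗ W_D; [last_fib g] is t. *)
Definition lift_of (g : fib n.+1 m) (w : fibprod rho (Dn n) ⊗ Dn 1) : Prop :=
  tmap (@fibprod1 _ _ _ _) w = N (last_fib g) /\ tmap (@fibprod2 _ _ _ _) w = curryD (incl g).

Lemma lift_compat g : tmap rho (N (last_fib g)) = tmap (@proj M (Dn n)) (curryD (incl g)).
Proof. by case: N_pseudo => _ -> _ _ _; rewrite /= tmap_proj_curryD. Qed.

(** The universal property is applied with the whole fibre as test space, so that the pair depends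
    smoothly on g; [lifted_smooth] relies on this. *)
Lemma lift_exists : exists2 U : fib n.+1 m -> fibprod rho (Dn n) ⊗ Dn 1,
  smooth U & forall g, lift_of g (U g).
Proof.
have [[sN _] _ _ _ _] := N_pseudo; have [sc _] := curryD_diffeo M_exp n.
have [|||U [sU h1 h2]] := @fibprod_lift _ _ _ FP _ _ (weil_Dn n) (weil_Dn 1) (fib n.+1 m)
  (fun g => N (last_fib g)) (fun g => curryD (incl g)).
- exact: (smooth_comp sN smooth_last_fib).
- exact: (smooth_comp sc (@smooth_incl _ _)).
- exact: lift_compat.
- by exists U => // g; split.
Qed.

Lemma lift_unique g w w' : lift_of g w -> lift_of g w' -> w = w'.
Proof.
move=> [h1 h2] [h1' h2']; apply: (fibprod_tmap_inj FP (weil_Dn n) (weil_Dn 1)).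
  by rewrite h1 h1'.
by rewrite h2 h2'.
Qed.

Variable f : fib n.+1 m -> E ⊗ Dn n.+1.
Hypothesis f_lift : forall g w, lift_of g w -> curryD (f g) = tmap Ev w.

(** The pattern of the equivariance proofs: transform the pair belonging to g, check that it belongs
    to the transformed argument, and evaluate. *)
Lemma lifted_eq g de w : lift_of g w -> curryD de = tmap Ev w -> f g = de.
Proof. by move=> h e; apply: (curryD_inj E_exp); rewrite (f_lift h) e. Qed.

Lemma lifted_smooth : smooth f.
Proof.
have [U sU hU] := lift_exists; have [_ [k [sk cK _]]] := curryD_diffeo E_exp n.
have -> : f = fun g => k (tmap Ev (U g)).
  by apply: functional_extensionality => g; rewrite -(f_lift (hU g)) cK.
exact: (smooth_comp sk (smooth_comp (tmap_smooth Ev_smooth) sU)).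
Qed.

Lemma proj_lifted g : proj (f g) = b0 (base N).
Proof.
have [U _ hU] := lift_exists; have [h1 _] := hU g.
(* Setting the last coordinate to 0 preserves the base point and turns the value into one of [Ev],
   whose base point is known. *)
rewrite -(@proj_pull E (Dn n.+1) (Dn n) (insert_map ord_max) (f g) (insert_map0 ord_max)).
rewrite -(proj_curryD E_exp) (f_lift (hU g)) proj_tmap.
rewrite proj_Ev -proj_tmap h1; case: N_pseudo => -[_ ->] //.
Qed.

Lemma tmap_lifted g : tmap pi (f g) = incl g.
Proof.
have [U _ hU] := lift_exists; have [_ h2] := hU g.
apply: (curryD_inj M_exp); rewrite -h2 (curryD_tmap _ E_exp M_exp pi_smooth) (f_lift (hU g)).
rewrite tmap_comp //; last exact: tmap_smooth.
exact: tmap_ext.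
Qed.

Lemma lifted_equivariant (Th : ('I_n.+1 -> R) -> 'I_n.+1 -> R) (Th0 : Th origin = origin)
    (th : ('I_n -> R) -> 'I_n -> R)
    (hth : forall x : M ⊗ Dn n, proj (pull (Dn n) (Dn n) th x) = proj x) g :
  @weil_hom (Dn n.+1) (Dn n.+1) Th -> @weil_hom (Dn n) (Dn n) th ->
  (forall a b j, Th (snoc (glue a b)) j = snoc (glue (th a) b) j) ->
  (forall z, Ev (fibprod_map (fun b => erefl (rho b)) hth z) = pull (Dn n) (Dn n) th (Ev z)) ->
  f (fpull Th0 g) = pull (Dn n.+1) (Dn n.+1) Th (f g).
Proof.
move=> wTh wth e hEv; have [U _ hU] := lift_exists; have [h1 h2] := hU g.
have sp : smooth (pull (Dn n) (Dn n) th : M ⊗ Dn n -> M ⊗ Dn n) by apply: pull_smooth.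
have sm := smooth_fibprod_map (fun b => erefl (rho b)) hth (@smooth_id B) sp.
pose w := tmap (fibprod_map (fun b => erefl (rho b)) hth) (U g).
apply: (@lifted_eq _ _ w); last first.
  rewrite curryD_regroup.
  rewrite (regroup_pull_in E_exp (@weil_hom_snoc n) _ (@weil_hom_snoc n) wTh wth e).
  rewrite -curryD_regroup (f_lift (hU g)) /w !tmap_comp //; last exact: pull_smooth.
  by apply: tmap_ext => z; rewrite hEv.
split.
- rewrite /w tmap_comp //; last exact: smooth_fibprod1.
  rewrite (_ : tmap _ _ = tmap (@fibprod1 _ _ _ _) (U g)); last exact: tmap_ext.
  rewrite h1; congr (N _); apply: incl_inj => /=.
  rewrite pull_comp //; last exact: weil_hom_last.
  (* The tangent vector t is unchanged: [Th] leaves the last coordinate alone and [th] fixes the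
     origin. *)
  apply: pull_ext => x j; rewrite /last_map e.
  by case: wth => _ -> _.
- rewrite /w tmap_comp //; last exact: smooth_fibprod2.
  rewrite /= curryD_regroup.
  rewrite (regroup_pull_in M_exp (@weil_hom_snoc n) _ (@weil_hom_snoc n) wTh wth e).
  rewrite -curryD_regroup -h2 tmap_comp //; last exact: smooth_fibprod2.
Qed.

Lemma lifted_scale_max a g :
  f (fpull (scale_map0 a ord_max) g) = pull (Dn n.+1) (Dn n.+1) (scale_map a ord_max) (f g).
Proof.
have [U _ hU] := lift_exists; have [h1 h2] := hU g.
have hs := @weil_hom_scale 1 a ord0; have hS := @weil_hom_scale n.+1 a ord_max.
have e a' b j : scale_map a ord_max (@snoc n (glue a' b)) j = snoc (glue a' (scale_map a ord0 b)) j.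
  move: j; apply: ord_snoc_ind => [j|].
    by rewrite /scale_map eq_sym (negbTE (neq_lift _ _)) !snoc_lift.
  by rewrite /scale_map !snoc_max eqxx.
pose w := pull (Dn 1) (Dn 1) (scale_map a ord0) (U g).
apply: (@lifted_eq _ _ w); last first.
  rewrite curryD_regroup.
  rewrite (regroup_pull_out E_exp (@weil_hom_snoc n) _ (@weil_hom_snoc n) hS hs e).
  by rewrite -curryD_regroup (f_lift (hU g)) pull_tmap.
split.
- rewrite /w -pull_tmap //; last exact: smooth_fibprod1.
  rewrite h1; case: N_pseudo => _ _ <- _ _; congr (N _); apply: incl_inj => /=.
  rewrite !pull_comp //; try exact: weil_hom_last.
  by apply: pull_ext => x j; rewrite /last_map e.
- rewrite /w -pull_tmap //; last exact: smooth_fibprod2.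
  rewrite /= curryD_regroup.
  rewrite (regroup_pull_out M_exp (@weil_hom_snoc n) _ (@weil_hom_snoc n) hS hs e).
  by rewrite -curryD_regroup -h2.
Qed.

(** A constant t equals 0 times t, so homogeneity with scalar 0 makes its image constant too. *)
Lemma pseudotangential_const (t : fib 1 (rho (base N))) :
  incl t = const_jet (Dn 1) (rho (base N)) -> N t = const_jet (Dn 1) (base N).
Proof.
case: N_pseudo => -[_ pN] _ sN _ _ e.
rewrite -(pN t) -(pull_scale0 ord0) -sN; congr (N _); apply: incl_inj => /=.
by rewrite pull_scale0 (proj2_sig t) e.
Qed.

Lemma base_fibP (g : fib n m) : proj (incl g) = rho (base N).
Proof. by rewrite -hm; exact: (proj2_sig g). Qed.

Definition base_fib (g : fib n m) : fibprod rho (Dn n) := exist _ (base N, incl g) (base_fibP g).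

Lemma lifted_hatproj (g : fib n m) :
  pull (Dn n.+1) (Dn n) (insert_map ord_max) (f (fpull (delete_map0 ord_max) g)) = Ev (base_fib g).
Proof.
have hd := @weil_hom_delete n ord_max.
have hl : lift_of (fpull (delete_map0 ord_max) g) (const_jet (Dn 1) (base_fib g)).
  split.
  - rewrite tmap_const_jet; last exact: smooth_fibprod1.
    rewrite pseudotangential_const //=; rewrite pull_comp //; last exact: weil_hom_last.
    rewrite -[in RHS](base_fibP g); case: (jetP (incl g)) => k sk ->.
    rewrite jet_pull //; last exact: weil_hom_comp hd (@weil_hom_last n).
    rewrite proj_jet; apply: jet_eq => x; congr k; apply: functional_extensionality => j.
    by rewrite /delete_map /last_map snoc_lift.
  - rewrite tmap_const_jet; last exact: smooth_fibprod2.
    by rewrite /= curryD_delete.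
by rewrite -(proj_curryD E_exp) (f_lift hl) tmap_const_jet // /const_jet proj_jet.
Qed.

End Step.

Section StepKappa.
Variables (B E M : frolicher) (rho : B -> M) (n : nat).
Variables (N : fibmap 1 rho) (Ev : fibprod rho (Dn n.+1) -> E ⊗ Dn n.+1).
Hypotheses (Ev_smooth : smooth Ev).
Hypotheses (E_exp : weil_exponentiable E) (M_exp : weil_exponentiable M).
Hypothesis (N_pseudo : pseudotangential N).
Variables (m : M) (hm : m = rho (base N)).
Variable f : fib n.+2 m -> E ⊗ Dn n.+2.
Hypothesis f_lift : forall g w, lift_of hm g w -> curryD (f g) = tmap Ev w.
Hypothesis proj_scale : forall a (x : M ⊗ Dn n.+1),
  proj (pull (Dn n.+1) (Dn n.+1) (scale_map a ord_max) x) = proj x.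
Hypothesis Ev_scale : forall a z,
  Ev (fibprod_map (fun b => erefl (rho b)) (proj_scale a) z)
  = pull (Dn n.+1) (Dn n.+1) (scale_map a ord_max) (Ev z).

Lemma lifted_kappa (g : fib n.+1 m) :
  f (fpull (kappa_map0 n) g) = pull (Dn n.+1) (Dn n.+2) (@kappa_map n) (Ev (base_fib hm g)).
Proof.
(* The jet of this family is the pair sought: its first component stays at the base of [N], while
   the second is g with its last coordinate scaled by b. *)
pose z (b : Rn 'I_1) := fibprod_map (fun b => erefl (rho b)) (proj_scale (b ord0)) (base_fib hm g).
have sz : smooth z.
  apply: smooth_to_fibprod; first exact: const_smooth.
  exact: (@smooth_pull_scale M (Dn 1) ord0).
have hl : lift_of hm (fpull (kappa_map0 n) g) (jet (Dn 1) z).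
  split.
  - rewrite (tmap_jet (W := Dn 1) (@smooth_fibprod1 _ _ _ _) sz).
    rewrite pseudotangential_const // /= -(tmap_proj_curryD M_exp) (curryD_kappa M_exp).
    rewrite (tmap_jet (W := Dn 1) (@proj_smooth _ _));
      last exact: (@smooth_pull_scale M (Dn 1) ord0).
    by apply: jet_eq => x; rewrite proj_scale; exact: (base_fibP hm g).
  - rewrite (tmap_jet (W := Dn 1) (@smooth_fibprod2 _ _ _ _) sz).
    by rewrite /= (curryD_kappa M_exp).
apply: (curryD_inj E_exp).
rewrite (f_lift hl) (curryD_kappa E_exp) (tmap_jet (W := Dn 1) Ev_smooth sz).
by apply: jet_eq => b; rewrite /z Ev_scale.
Qed.

End StepKappa.

(** * Symmetry in the last two coordinates *)

(** A transposition moving the last index is conjugate to that of the last two indices, by a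
    transposition fixing the last index; every permutation is a product of transpositions. *)
Lemma perm_snoc_ind n (P : 'S_n.+2 -> Prop) :
  (forall s t, P s -> P t -> P (s * t)%g) ->
  (forall i j : 'I_n.+1, P (tperm (lift ord_max i) (lift ord_max j))) ->
  P (tperm (lift ord_max ord_max) ord_max) -> forall s, P s.
Proof.
move=> hM hl hm.
have hi i : P (tperm (lift ord_max i) ord_max).
  have := hM _ _ (hM _ _ (hl i ord_max) hm) (hl i ord_max).
  have -> : (tperm (lift ord_max i) (lift ord_max ord_max) * tperm (lift ord_max ord_max) ord_max
             * tperm (lift ord_max i) (lift ord_max ord_max))%g
          = (tperm (lift ord_max ord_max) ord_max ^
             tperm (lift ord_max i) (lift ord_max ord_max))%g.
    by rewrite /conjg tpermV mulgA.
  by rewrite tpermJ tpermR tpermD // eq_sym neq_lift.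
have P1 : P 1%g by rewrite -(tperm1 (lift ord_max ord0)).
move=> s; have [ts -> _] := prod_tpermP s.
elim: ts => [|[i j] ts IH]; rewrite ?big_nil ?big_cons //=; apply: hM => //.
move: i; apply: ord_snoc_ind => [i|]; move: j; apply: ord_snoc_ind => [j|] //.
- by rewrite tpermC.
- by rewrite tperm1.
Qed.

Lemma smooth_jbase (n : nat) (B M : frolicher) (rho : B -> M) (S : fibmap n rho -> Prop) :
  smooth (@jbase n B M rho S).
Proof.
apply: (smooth_comp (g := fun c : fibspace n rho => base c) _ (@smooth_incl _ _)).
by apply: smooth_gen_curves => c [sc _]; apply: smooth_curve.
Qed.

Lemma smooth_jproj (n : nat) (B M : frolicher) (rho : B -> M) (S : fibmap n rho -> Prop) :
  smooth rho -> smooth (@jproj n B M rho S).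
Proof. by move=> sr; exact: (smooth_comp sr (@smooth_jbase _ _ _ _ _)). Qed.

Section Evaluation.
Variables (n : nat) (B M : frolicher) (rho : B -> M) (S : fibmap n rho -> Prop).
Hypothesis S_pseudo : forall x, S x -> pseudotangential x.
Implicit Types z : fibprod (@jproj n B M rho S) (Dn n).

Lemma proj_ev z : proj (ev z) = jbase (fibprod1 z).
Proof. by case: (S_pseudo (proj2_sig (fibprod1 z))) => -[_ h] _ _ _ _; apply: h. Qed.

Lemma tmap_ev z : tmap rho (ev z) = fibprod2 z.
Proof. by case: (S_pseudo (proj2_sig (fibprod1 z))) => _ h _ _ _; rewrite /ev h. Qed.

End Evaluation.

Section PhiSwap.
Variables (B M : frolicher) (rho : B -> M) (S : fibmap 1 rho -> Prop).
Let rho2 := @jproj 1 B M rho S.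
Hypotheses (B_exp : weil_exponentiable B) (M_exp : weil_exponentiable M).
Hypotheses (FP : fibprod_preserved rho2).
Variable N : fibmap 1 rho2.
Hypothesis N_comp : compatible N.
Variables (m : M) (hm : m = rho2 (base N)).

(* [f2] is the mapping Phi. *)
Lemma Phi_swap : exists f2 : fib 2 m -> B ⊗ Dn 2,
  (forall g w, lift_of hm g w -> curryD (f2 g) = tmap (@ev 1 B M rho S) w) /\
  forall g, f2 (fpull (perm_map0 (tperm ord0 ord_max)) g)
            = pull (Dn 2) (Dn 2) (perm_map (tperm ord0 ord_max)) (f2 g).
Proof.
subst m; have [N_pseudo _ hPhi] := N_comp.
have [U _ hU] := lift_exists 1 M_exp FP N_pseudo erefl.
have [_ [k [_ _ kK]]] := curryD_diffeo B_exp 1.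
pose f2 g := k (tmap (@ev 1 B M rho S) (U g)).
have hl g w : lift_of erefl g w -> curryD (f2 g) = tmap (@ev 1 B M rho S) w.
  by move=> h; rewrite /f2 kK (lift_unique FP h (hU g)).
exists f2; split=> // g.
have lastE (h : fib 2 (rho2 (base N))) : last_fib erefl h = fpull (insert_map0 ord0) h.
  apply: incl_inj; apply: pull_ext => x; apply: ord_snoc_ind => [j|].
    rewrite /last_map snoc_lift /insert_map (ord1 j).
    by rewrite (_ : lift ord_max ord0 = ord0) ?unlift_none //; apply: val_inj.
  rewrite /last_map snoc_max /insert_map /=.
  by rewrite (_ : ord_max = lift ord0 ord0) ?liftK //; apply: val_inj.
have [h1 h2] := hU g; rewrite lastE in h1.
have [|u [u1 u2 u3]] := hPhi g (f2 g).
  by exists (U g); split=> //; apply: hl.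
apply: (curryD_inj B_exp); rewrite u3; apply: hl; split=> //.
by rewrite u1 lastE.
Qed.

End PhiSwap.

Section Swap.
Variables (B E M : frolicher) (rho : B -> M) (S : fibmap 1 rho -> Prop) (n : nat).
Let rho2 := @jproj 1 B M rho S.
Hypothesis S_pseudo : forall x, S x -> pseudotangential x.
Hypothesis rho_smooth : smooth rho.
Hypothesis ev_smooth : smooth (@ev 1 B M rho S).
Hypotheses (B_exp : weil_exponentiable B) (M_exp : weil_exponentiable M).
Hypotheses (E_exp : weil_exponentiable E) (EW_exp : weil_exponentiable (E ⊗ Dn n)).
Hypotheses (MW_exp : weil_exponentiable (M ⊗ Dn n)).
Hypothesis FPW_exp : weil_exponentiable (fibprod rho (Dn n)).
Hypotheses (FP : fibprod_preserved rho) (FP2 : fibprod_preserved rho2).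
Variables (Ev : fibprod rho (Dn n) -> E ⊗ Dn n) (Ev2 : fibprod rho2 (Dn n.+1) -> E ⊗ Dn n.+1).
Hypotheses (Ev_smooth : smooth Ev) (Ev2_smooth : smooth Ev2).

Lemma proj_last (x : M ⊗ Dn n.+1) : proj (pull (Dn n.+1) (Dn 1) (@last_map n) x) = proj x.
Proof. exact: (@proj_pull M (Dn n.+1) (Dn 1) (@last_map n) x (@last_map0 n)). Qed.

Definition last_fibprod : fibprod rho2 (Dn n.+1) -> fibprod rho2 (Dn 1) :=
  fibprod_map (fun b => erefl (rho2 b)) proj_last.

Hypothesis Ev2_rec : forall z w,
  tmap (@fibprod1 _ _ _ _) w = ev (last_fibprod z) ->
  tmap (@fibprod2 _ _ _ _) w = curryD (fibprod2 z) -> curryD (Ev2 z) = tmap Ev w.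

Variable N : fibmap 1 rho2.
Hypothesis N_comp : compatible N.
Variables (m : M) (hm : m = rho2 (base N)).
Variable f : fib n.+2 m -> E ⊗ Dn n.+2.
Hypothesis f_lift : forall g w, lift_of hm g w -> curryD (f g) = tmap Ev2 w.

Let s2 : 'S_2 := tperm ord0 ord_max.
Let sn : 'S_n.+2 := tperm (lift ord_max ord_max) ord_max.

(** Pulling back along it restricts g to its last two coordinates, which gives the argument of
    Phi. *)
Definition last2_map (b : 'I_2 -> R) : 'I_n.+2 -> R := snoc2 (glue origin b).

Lemma weil_hom_last2 : @weil_hom (Dn n.+2) (Dn 2) last2_map.
Proof.
apply: Dn_weil_hom.
- apply: ord_snoc_ind => [|]; first apply: ord_snoc_ind => [j|].
  + by apply: Cinf_ext (Cinf_const 0) => x; rewrite /last2_map snoc2_lift.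
  + by apply: Cinf_ext (Cinf_coord ord0) => x; rewrite /last2_map snoc2_pre.
  + by apply: Cinf_ext (Cinf_coord ord_max) => x; rewrite /last2_map snoc2_max.
- apply: functional_extensionality; rewrite /last2_map.
  apply: ord_snoc_ind => [|]; first apply: ord_snoc_ind => [j|].
  + by rewrite snoc2_lift.
  + by rewrite snoc2_pre.
  + by rewrite snoc2_max.
- rewrite /last2_map; apply: ord_snoc_ind => [|]; first apply: ord_snoc_ind => [j|].
  + apply: (@ideal_ext (Dn 2) _ (fun _ => 0)) => [z|]; last exact: ideal0.
    by rewrite snoc2_lift /= Rmult_0_l.
  + apply: (@ideal_ext (Dn 2) _ (fun z => z ord0 ^ 2)) => [z|]; last exact: Dn_ideal_sq.
    by rewrite snoc2_pre.
  + apply: (@ideal_ext (Dn 2) _ (fun z => z ord_max ^ 2)) => [z|]; last exact: Dn_ideal_sq.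
    by rewrite snoc2_max.
Qed.

Lemma last2_map0 : last2_map origin = origin.
Proof. by case: weil_hom_last2. Qed.

Lemma snoc2_swap a b j : perm_map sn (snoc2 (glue a b)) j = @snoc2 n (glue a (perm_map s2 b)) j.
Proof.
rewrite /perm_map /sn /s2; move: j; apply: ord_snoc_ind => [|]; first apply: ord_snoc_ind => [j|].
- rewrite tpermD ?snoc2_lift //; last by rewrite neq_lift.
  by rewrite (inj_eq lift_inj) neq_lift.
- by rewrite tpermL snoc2_pre snoc2_max /= tpermL.
- by rewrite tpermR snoc2_pre snoc2_max /= tpermR.
Qed.

(** Two levels of recursion merge into one evaluation over D^2. The result involves nabla through
    [f2] only, and there the symmetry is known. *)
Lemma lifted_factor (f2 : fib 2 m -> B ⊗ Dn 2) :
  (forall g w, lift_of hm g w -> curryD (f2 g) = tmap (@ev 1 B M rho S) w) ->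
  forall g, exists v : fibprod rho (Dn n) ⊗ Dn 2,
    [/\ curry2 (f g) = tmap Ev v, tmap (@fibprod1 _ _ _ _) v = f2 (fpull last2_map0 g) &
        tmap (@fibprod2 _ _ _ _) v = curry2 (incl g)].
Proof.
move=> hf2 g; have [N_pseudo _ _] := N_comp.
have rho2_smooth : smooth rho2 by apply: smooth_jproj.
have sl : smooth last_fibprod.
  by apply: smooth_fibprod_map => //; apply: pull_smooth; apply: weil_hom_last.
have scM n' : smooth (@curryD M n') by case: (curryD_diffeo M_exp n').
have scE n' : smooth (@curryD E n') by case: (curryD_diffeo E_exp n').
(* The pairs of the lower level form a smooth family [W] over the upper fibre product, so [W] can be
   prolonged and applied to the upper pair [U g]. *)
have [|||W [sW W1 W2]] := @fibprod_lift _ _ _ FP _ _ (weil_Dn n) (weil_Dn 1)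
  (fibprod rho2 (Dn n.+1)) (fun z => ev (last_fibprod z)) (fun z => curryD (fibprod2 z)).
- exact: (smooth_comp ev_smooth sl).
- exact: (smooth_comp (scM n) (@smooth_fibprod2 _ _ _ _)).
- by move=> z; rewrite tmap_ev // tmap_proj_curryD.
have [U _ hU] := lift_exists n.+1 M_exp FP2 N_pseudo hm; have [h1 h2] := hU g.
have [_ [k [_ _ kK]]] := curryD_diffeo FPW_exp 1.
have s1 := @smooth_fibprod1 _ _ rho (Dn n); have s2' := @smooth_fibprod2 _ _ rho (Dn n).
(* [k] inverts [curryD] on the lower fibre product, turning nested jets over D into one over D^2. *)
exists (k (tmap W (U g))); split.
- apply: (curryD_inj EW_exp); rewrite (curryD_curry2 _ E_exp EW_exp) (f_lift (hU g)).
  rewrite (curryD_tmap _ FPW_exp EW_exp Ev_smooth) kK !tmap_comp //; last exact: tmap_smooth.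
  by apply: tmap_ext => z; apply: Ev2_rec.
- apply: (curryD_inj B_exp).
  rewrite (curryD_tmap _ FPW_exp B_exp s1) kK tmap_comp //; last exact: tmap_smooth.
  (* Restricting the second entry of [U g] to its last coordinate gives the pair that defines Phi at
     the restricted argument. *)
  rewrite (tmap_ext _ W1) (hf2 _ (tmap last_fibprod (U g))).
    by rewrite tmap_comp.
  split.
  + rewrite tmap_comp //; last exact: smooth_fibprod1.
    rewrite (_ : tmap _ _ = tmap (@fibprod1 _ _ _ _) (U g)); last exact: tmap_ext.
    rewrite h1; congr (N _); apply: incl_inj => /=.
    rewrite pull_comp; [|exact: weil_hom_last2|exact: weil_hom_last].
    apply: pull_ext => x; apply: ord_snoc_ind => [|]; first apply: ord_snoc_ind => [j|].
    * by rewrite /last2_map snoc2_lift /last_map snoc_lift.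
    * rewrite /last2_map snoc2_pre /last_map snoc_lift /=.
      by rewrite (_ : ord0 = lift ord_max ord0) ?snoc_lift //; apply: val_inj.
    * by rewrite /last2_map snoc2_max /= /last_map !snoc_max.
  + rewrite tmap_comp //; last exact: smooth_fibprod2.
    rewrite /= curryD_regroup (regroup_pull_in M_exp (@weil_hom_snoc 1) _ (@weil_hom_snoc n.+1)
      weil_hom_last2 (@weil_hom_last n)).
      rewrite -curryD_regroup -h2 tmap_comp //; first by apply: pull_smooth; apply: weil_hom_last.
      exact: smooth_fibprod2.
    move=> a b; apply: ord_snoc_ind => [|]; first apply: ord_snoc_ind => [j|].
    * by rewrite /last2_map snoc2_lift snoc_lift /= /last_map snoc_lift.
    * rewrite /last2_map snoc2_pre snoc_lift /= /last_map snoc_max /=.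
      by rewrite (_ : ord0 = lift ord_max ord0) ?snoc_lift //; apply: val_inj.
    * by rewrite /last2_map snoc2_max /= !snoc_max.
- apply: (curryD_inj MW_exp).
  rewrite (curryD_tmap _ FPW_exp MW_exp s2') kK tmap_comp //; last exact: tmap_smooth.
  rewrite (tmap_ext _ W2) (curryD_curry2 _ M_exp MW_exp) -h2 tmap_comp //.
  exact: smooth_fibprod2.
Qed.

Lemma lifted_swap g : f (fpull (perm_map0 sn) g) = pull (Dn n.+2) (Dn n.+2) (perm_map sn) (f g).
Proof.
have [f2 [hf2 f2s]] := Phi_swap B_exp M_exp FP2 N_comp hm.
have [v [v1 v2 v3]] := lifted_factor hf2 g.
have [v' [v1' v2' v3']] := lifted_factor hf2 (fpull (perm_map0 sn) g).
have hs := weil_hom_perm s2; have hsn := weil_hom_perm sn.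
(* Both components of [v'] are those of [v] swapped, the first by the symmetry of [f2], the second
   by [snoc2_swap]; components determine the pair. *)
have ev' : v' = pull (Dn 2) (Dn 2) (perm_map s2) v.
  apply: (fibprod_tmap_inj FP (weil_Dn n) (weil_Dn 2)).
  - rewrite v2' -pull_tmap //; last exact: smooth_fibprod1.
    rewrite v2 -f2s; congr f2; apply: incl_inj => /=.
    rewrite !pull_comp //; try exact: weil_hom_last2.
    by apply: pull_ext => x j; rewrite /last2_map snoc2_swap.
  - rewrite v3' -pull_tmap //; last exact: smooth_fibprod2.
    rewrite v3 /curry2 /=.
    exact: (regroup_pull_out M_exp (@weil_hom_snoc2 n) _ (@weil_hom_snoc2 n) hsn hs snoc2_swap).
apply: (curry2_inj E_exp EW_exp).
rewrite v1' ev' -pull_tmap // -v1 /curry2.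
exact/esym/(regroup_pull_out E_exp (@weil_hom_snoc2 n) _ (@weil_hom_snoc2 n) hsn hs snoc2_swap).
Qed.

End Swap.

(** * The mappings phi_n *)

Lemma tangential_pseudo n (E M : frolicher) (pi : E -> M) (nab : fibmap n pi) :
  tangential nab -> pseudotangential nab.
Proof. by case: n nab => [|[|n]] nab //= []. Qed.

Lemma tower_pred_pseudo (E M : frolicher) (pi : E -> M) k (x : fibmap 1 (J_proj pi k)) :
  @lev_pred M (tower pi k) x -> pseudotangential x.
Proof. by case: k x => [|k] x //= []. Qed.

Lemma J_proj_base (E M : frolicher) (pi : E -> M) k (x : J pi k) :
  J_proj pi k x = pi (J_base pi k x).
Proof. by elim: k x => [|k IH] x //=; rewrite -IH. Qed.

Lemma J_proj_smooth (E M : frolicher) (pi : E -> M) k : smooth pi -> smooth (J_proj pi k).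
Proof. by move=> sp; elim: k => [|k IH] //; apply: smooth_jproj. Qed.

(** A [fibmap] carries its base point as data, so the induction has to record it in order to match
    fibres. *)
Definition phi_tangential (E M : frolicher) (pi : E -> M) n : Prop :=
  forall x : J pi n, base (phi pi n x) = J_base pi n x /\ tangential (phi pi n x).

Section PhiMap.
Variables (E M : frolicher) (pi : E -> M) (n : nat).
Hypothesis ok : phi_tangential pi n.

Definition phi_map (x : J pi n) : JD pi n := exist _ (phi pi n x) (proj2 (ok x)).

Lemma JD_proj_phi x : JD_proj pi n (phi_map x) = J_proj pi n x.
Proof. by rewrite J_proj_base -(proj1 (ok x)). Qed.

Definition phi_pair : fibprod (J_proj pi n) (Dn n) -> fibprod (JD_proj pi n) (Dn n) :=
  fibprod_map JD_proj_phi (fun x : M ⊗ Dn n => erefl (proj x)).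

(** The evaluation (y, c) |-> phi_n(y)(c), routed through [JD] because smoothness is given for
    [JD_ev] and for phi_n as a map into [JD]. *)
Definition phi_ev (z : fibprod (J_proj pi n) (Dn n)) : E ⊗ Dn n := JD_ev pi n (phi_pair z).

Lemma phi_evE z (g : fib n (pi (base (phi pi n (fibprod1 z))))) :
  incl g = fibprod2 z -> phi_ev z = phi pi n (fibprod1 z) g.
Proof. by move=> e; apply: fibmap_app_eq. Qed.

Lemma phi_pseudo x : pseudotangential (phi pi n x).
Proof. by apply: tangential_pseudo; case: (ok x). Qed.

Lemma proj_phi_ev z : proj (phi_ev z) = J_base pi n (fibprod1 z).
Proof.
rewrite /phi_ev proj_ev; first by rewrite -(proj1 (ok _)).
exact: tangential_pseudo.
Qed.

Lemma tmap_phi_ev z : tmap pi (phi_ev z) = fibprod2 z.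
Proof.
rewrite /phi_ev /JD_ev (tmap_ev (S := @tangential n E M pi)) //; exact: tangential_pseudo.
Qed.

Lemma phi_ev_equivariant (th : ('I_n -> R) -> 'I_n -> R) (th0 : th origin = origin)
    (hth : forall x : M ⊗ Dn n, proj (pull (Dn n) (Dn n) th x) = proj x) :
  (forall x g, phi pi n x (fpull th0 g) = pull (Dn n) (Dn n) th (phi pi n x g)) ->
  forall z, phi_ev (fibprod_map (fun b => erefl (J_proj pi n b)) hth z)
            = pull (Dn n) (Dn n) th (phi_ev z).
Proof.
move=> h z.
have hz : proj (fibprod2 z) = pi (base (phi pi n (fibprod1 z))).
  by rewrite fibprodP J_proj_base (proj1 (ok _)).
pose g : fib n (pi (base (phi pi n (fibprod1 z)))) := exist _ (fibprod2 z) hz.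
by rewrite (@phi_evE z g) // -h; apply: phi_evE.
Qed.

End PhiMap.

Section Main.
Variables (E M : frolicher) (pi : E -> M).
Hypotheses (pi_smooth : smooth pi) (E_adm : admissible E) (M_adm : admissible M).
Hypothesis J_adm : forall k, admissible (J pi k).
Hypothesis J_fibprod_adm : forall k W, weil W -> admissible (fibprod (J_proj pi k) W).
Hypothesis J_fibprod : forall k, fibprod_preserved (J_proj pi k).
Hypothesis JD_fibprod : forall k, fibprod_preserved (JD_proj pi k).
Hypothesis J_ev_smooth : forall k, smooth (J_ev pi k).
Hypothesis JD_ev_smooth : forall k, smooth (JD_ev pi k).
Hypothesis phi_smooth : forall k (f : J pi k -> JD pi k),
  (forall x, incl (f x) = phi pi k x) -> smooth f.

Let E_exp : weil_exponentiable E. Proof. by case: E_adm. Qed.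
Let M_exp : weil_exponentiable M. Proof. by case: M_adm. Qed.

Lemma phi_pair_smooth n (ok : phi_tangential pi n) : smooth (phi_pair ok).
Proof. by apply: smooth_fibprod_map => //; apply: phi_smooth. Qed.

Lemma phi_ev_smooth n (ok : phi_tangential pi n) : smooth (phi_ev ok).
Proof. exact: (smooth_comp (@JD_ev_smooth n) (phi_pair_smooth ok)). Qed.

Lemma J_base_proj n (nab : J pi n.+1) :
  pi (J_base pi n (J_down pi n nab)) = J_proj pi n (base (J_fibmap nab)).
Proof. exact/esym/J_proj_base. Qed.

Lemma J_pseudo n (nab : J pi n.+1) : pseudotangential (J_fibmap nab).
Proof. exact: tower_pred_pseudo (proj2_sig nab). Qed.

(** Removes [epsilon]: a value exists, and each witness in [phi_value] is forced, [ph'] and [t] by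
    injectivity of [incl], [u] by its two components. *)
Lemma phi_next_lift n (ok : phi_tangential pi n) (nab : J pi n.+1) g w :
  lift_of (J_base_proj nab) g w ->
  curryD (phi_next (phi pi n) nab g) = tmap (phi_ev ok) w.
Proof.
move=> [h1 h2]; rewrite /=.
have [sc [k [_ _ kK]]] := curryD_diffeo E_exp n.
have sp := phi_pair_smooth ok.
have s1 := @smooth_fibprod1 _ _ (JD_proj pi n) (Dn n).
have s2 := @smooth_fibprod2 _ _ (JD_proj pi n) (Dn n).
have s1' := @smooth_fibprod1 _ _ (J_proj pi n) (Dn n).
have sphi : smooth (phi_map ok) by apply: phi_smooth.
set P := phi_value _ _ _; have : exists de, P de.
  exists (k (tmap (phi_ev ok) w)), (phi_map ok), (last_fib (J_base_proj nab) g),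
    (tmap (phi_pair ok) w); split=> //; split.
  - by rewrite tmap_proj_curryD.
  - by rewrite -h1 !tmap_comp.
  - by rewrite -h2 !tmap_comp.
  - by rewrite kK tmap_comp.
move/(epsilon_spec (inhabits (const_jet (Dn n.+1) (J_base pi n (J_down pi n nab))))).
move: (epsilon _ _) => de [ph' [t [u [hph [e0 e1 e2 ->]]]]].
have eph : ph' = phi_map ok.
  by apply: functional_extensionality => x; apply: incl_inj; rewrite hph.
have et : t = last_fib (J_base_proj nab) g.
  by apply: incl_inj; rewrite e0 tmap_proj_curryD.
have -> : u = tmap (phi_pair ok) w.
  apply: (fibprod_tmap_inj (@JD_fibprod n) (weil_Dn n) (weil_Dn 1)).
  - by rewrite e1 eph et -h1 !tmap_comp.
  - by rewrite e2 -h2 !tmap_comp.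
by rewrite tmap_comp.
Qed.

(** As phi_1 is the identity, there is no second recursion to unfold; instead phi_2(nabla) is the
    map Phi itself. *)
Lemma phi_next_swap1 (ok : phi_tangential pi 1) (nab : J pi 2) g :
  let s := tperm (lift ord_max ord_max) ord_max : 'S_2 in
  phi_next (phi pi 1) nab (fpull (perm_map0 s) g)
  = pull (Dn 2) (Dn 2) (perm_map s) (phi_next (phi pi 1) nab g).
Proof.
move=> s; have hl := @phi_next_lift 1 ok nab.
have N_comp : @compatible _ _ _ (@lev_pred M (tower pi 0)) (J_fibmap nab) := proj2_sig nab.
have [f2 [hf2 f2s]] := Phi_swap E_exp M_exp (@J_fibprod 1) N_comp (J_base_proj nab).
have e h : phi_next (phi pi 1) nab h = f2 h.
  have [U _ hU] := lift_exists 1 M_exp (@J_fibprod 1) (J_pseudo nab) (J_base_proj nab).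
  apply: (curryD_inj E_exp); rewrite (hl _ _ (hU h)) (hf2 _ _ (hU h)).
  by apply: tmap_ext => z; apply: fibmap_app_eq.
have es : s = tperm ord0 ord_max by rewrite /s; congr tperm; apply: val_inj.
by rewrite es !e -f2s; congr f2; apply: incl_inj.
Qed.

(** Provides [Ev2_rec]: from level 2 on, phi is given by [phi_next]. *)
Lemma phi_ev_rec n (ok : phi_tangential pi n.+1) (ok' : phi_tangential pi n.+2) z w :
  tmap (@fibprod1 _ _ _ _) w = J_ev pi n.+1 (last_fibprod z) ->
  tmap (@fibprod2 _ _ _ _) w = curryD (fibprod2 z) ->
  curryD (phi_ev ok' z) = tmap (phi_ev ok) w.
Proof.
move=> h1 h2.
have hz : proj (fibprod2 z) = pi (base (phi pi n.+2 (fibprod1 z))).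
  by rewrite (proj1 (ok' _)) -J_proj_base; apply: fibprodP.
pose g : fib n.+2 (pi (base (phi pi n.+2 (fibprod1 z)))) := exist _ (fibprod2 z) hz.
rewrite (@phi_evE _ _ _ _ ok' z g) //; apply: phi_next_lift; split=> //.
by rewrite h1; apply: fibmap_app_eq.
Qed.

Lemma phi_next_swapS k (ok1 : phi_tangential pi k.+1) (ok2 : phi_tangential pi k.+2)
    (nab : J pi k.+3) g :
  let s := tperm (lift ord_max ord_max) ord_max : 'S_k.+3 in
  phi_next (phi pi k.+2) nab (fpull (perm_map0 s) g)
  = pull (Dn k.+3) (Dn k.+3) (perm_map s) (phi_next (phi pi k.+2) nab g).
Proof.
have N_comp : @compatible _ _ _ (@lev_pred M (tower pi k.+1)) (J_fibmap nab) := proj2_sig nab.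
have [J_exp _ _] := J_adm k.+1.
have [_ _ EW] := E_adm; have [_ _ MW] := M_adm.
have [EW_exp _] := EW _ (weil_Dn k.+1); have [MW_exp _] := MW _ (weil_Dn k.+1).
have [FPW_exp _ _] := @J_fibprod_adm k.+1 _ (weil_Dn k.+1).
move=> s.
have := (@lifted_swap _ _ _ _ _ _ (@tower_pred_pseudo _ _ pi k.+1)
  (@J_proj_smooth _ _ pi k.+1 pi_smooth)
  (@J_ev_smooth k.+1) J_exp M_exp E_exp EW_exp MW_exp
  FPW_exp (@J_fibprod k.+1) (@J_fibprod k.+2) _ _ (phi_ev_smooth ok1) (phi_ev_smooth ok2)
  (phi_ev_rec ok1 ok2) _ N_comp _ (J_base_proj nab) _ (@phi_next_lift k.+2 ok2 nab) g); exact.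
Qed.

(** Symmetry in the last two coordinates is left as a hypothesis, since it has different proofs for
    k = 0 and for k > 0. *)
Lemma phi_tangential_next k :
  phi_tangential pi k.+1 ->
  (forall (nab : J pi k.+2) g, let s := tperm (lift ord_max ord_max) ord_max : 'S_k.+2 in
     phi_next (phi pi k.+1) nab (fpull (perm_map0 s) g)
     = pull (Dn k.+2) (Dn k.+2) (perm_map s) (phi_next (phi pi k.+1) nab g)) ->
  phi_tangential pi k.+2.
Proof.
move=> ok hswap nab; split=> //.
pose n := k.+1; pose f : fib n.+1 _ -> E ⊗ Dn n.+1 := phi_next (phi pi n) nab.
have N_pseudo := J_pseudo nab; have hl := @phi_next_lift n ok nab.
have FP := @J_fibprod n.
have sEv := phi_ev_smooth ok.
have psM (th : ('I_n -> R) -> 'I_n -> R) (th0 : th origin = origin) (x : M ⊗ Dn n) :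
    proj (pull (Dn n) (Dn n) th x) = proj x := @proj_pull M (Dn n) (Dn n) th x th0.
have Ev_scale a i z :
    phi_ev ok (fibprod_map (fun b => erefl (J_proj pi n b)) (psM _ (scale_map0 a i)) z)
    = pull (Dn n) (Dn n) (scale_map a i) (phi_ev ok z).
  apply: (phi_ev_equivariant ok (th0 := scale_map0 a i)) => x g.
  by case: (phi_pseudo ok x).
have Ev_perm s z :
    phi_ev ok (fibprod_map (fun b => erefl (J_proj pi n b)) (psM _ (perm_map0 s)) z)
    = pull (Dn n) (Dn n) (perm_map s) (phi_ev ok z).
  apply: (phi_ev_equivariant ok (th0 := perm_map0 s)) => x g.
  by case: (phi_pseudo ok x).
have hscale a i g : f (fpull (scale_map0 a i) g) = pull (Dn n.+1) (Dn n.+1) (scale_map a i) (f g).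
  move: i g; apply: ord_snoc_ind => [i|] g;
    last exact: (lifted_scale_max sEv E_exp M_exp FP N_pseudo hl).
  apply: (@lifted_equivariant _ _ _ _ _ _ _ sEv E_exp M_exp FP N_pseudo _ _ _ hl
    (scale_map a (lift ord_max i)) (scale_map0 a (lift ord_max i)) _ _ g _ _ _ (Ev_scale a i)).
  - exact: weil_hom_scale.
  - exact: weil_hom_scale.
  - move=> a' b; apply: ord_snoc_ind => [j|].
      by rewrite /scale_map (inj_eq lift_inj) !snoc_lift.
    by rewrite /scale_map (negbTE (neq_lift _ _)) !snoc_max.
have hsm : smooth f := lifted_smooth sEv E_exp M_exp FP N_pseudo hl.
have hperm s g : f (fpull (perm_map0 s) g) = pull (Dn n.+1) (Dn n.+1) (perm_map s) (f g).
  move: s g; apply: perm_snoc_ind => [s t hs ht|i j|] g; last exact: hswap.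
    have -> : fpull (perm_map0 (s * t)%g) g = fpull (perm_map0 t) (fpull (perm_map0 s) g).
      apply: incl_inj => /=; rewrite pull_comp; [|exact: weil_hom_perm|exact: weil_hom_perm].
      by apply: pull_ext => x j; rewrite /perm_map permM.
    rewrite ht hs pull_comp; [|exact: weil_hom_perm|exact: weil_hom_perm].
    by apply: pull_ext => x j; rewrite /perm_map permM.
  apply: (@lifted_equivariant _ _ _ _ _ _ _ sEv E_exp M_exp FP N_pseudo _ _ _ hl
    (perm_map (tperm (lift ord_max i) (lift ord_max j))) (perm_map0 _) _ _ g _ _ _
    (Ev_perm (tperm i j))).
  - exact: weil_hom_perm.
  - exact: weil_hom_perm.
  - move=> a b; apply: ord_snoc_ind => [l|].
      by rewrite /perm_map -inj_tperm ?snoc_lift //; apply: lift_inj.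
    by rewrite /perm_map tpermD ?snoc_max // eq_sym neq_lift.
have ehat : hatproj (phi pi n.+1 nab) = phi pi n (J_down pi n nab).
  apply: fibmap_eq => [|ga gb e /=]; first by rewrite (proj1 (ok _)).
  rewrite (lifted_hatproj sEv E_exp M_exp N_pseudo hl).
  exact: (phi_evE ok).
split.
- split.
  + split=> //= g; exact: (proj_lifted E_exp M_exp FP N_pseudo (proj_phi_ev ok) hl).
  + exact: (tmap_lifted pi_smooth sEv E_exp M_exp FP N_pseudo (tmap_phi_ev ok) hl).
  + exact: hscale.
  + exact: (mu_of_scale E_exp M_exp hsm hscale).
  + exact: hperm.
- by change (tangential (hatproj (phi pi n.+1 nab))); rewrite ehat; case: (ok (J_down pi n nab)).
- move=> g; rewrite [RHS](_ : _ = pull (Dn n) (Dn n.+1) (@kappa_map k)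
                                  (phi_ev ok (base_fib (J_base_proj nab) g))).
    exact: (lifted_kappa sEv E_exp M_exp N_pseudo hl (fun a => Ev_scale a ord_max)).
  congr (pull _ _ _ _).
  exact: (lifted_hatproj sEv E_exp M_exp N_pseudo hl).
Qed.

Lemma phi_tangentialP k : phi_tangential pi k.+1.
Proof.
(* Two consecutive levels are carried along because [phi_next_swapS] evaluates at both. *)
suff [] : phi_tangential pi k.+1 /\ phi_tangential pi k.+2 by [].
have ok1 : phi_tangential pi 1.
  by move=> x; split=> //; exact: (proj2_sig x).
elim: k => [|k [IH1 IH2]]; split=> //.
- by apply: phi_tangential_next => // nab g; apply: phi_next_swap1.
- by apply: phi_tangential_next => // nab g; apply: phi_next_swapS.
Qed.

End Main.

Theorem lemma72 (E M : frolicher) (pi : E -> M) (pi_smooth : smooth pi)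
  (* all spaces occurring are microlinear and Weil exponentiable *)
  (E_adm : admissible E) (M_adm : admissible M)
  (J_adm : forall k, admissible (J pi k))
  (JD_adm : forall k, admissible (JD pi k))
  (J_fibprod_adm : forall k W, weil W -> admissible (fibprod (J_proj pi k) W))
  (JD_fibprod_adm : forall k W, weil W -> admissible (fibprod (JD_proj pi k) W))
  (* Weil functors preserve the fibre products in use *)
  (J_fibprod : forall k, fibprod_preserved (J_proj pi k))
  (JD_fibprod : forall k, fibprod_preserved (JD_proj pi k))
  (* evaluations and the mappings phi_k are smooth *)
  (J_ev_smooth : forall k, smooth (J_ev pi k))
  (JD_ev_smooth : forall k, smooth (JD_ev pi k))
  (phi_smooth : forall k (f : J pi k -> JD pi k),
     (forall x, incl (f x) = phi pi k x) -> smooth f)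
  (n : nat) (n_ge1 : (1 <= n)%N)
  (xn : J pi n) (nabla : J pi n.+1) (nabla_xn : J_down pi n nabla = xn) :
  base (phi pi n.+1 nabla) = J_base pi n xn /\ tangential (phi pi n.+1 nabla).
Proof.
rewrite -nabla_xn; have [-> ht] := phi_tangentialP pi_smooth E_adm M_adm J_adm J_fibprod_adm
  J_fibprod JD_fibprod J_ev_smooth JD_ev_smooth phi_smooth nabla.
by split.
Qed.
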